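(* Let $U=U_q(\mathfrak{sl}_2)$ with Casimir element $C$, comultiplication $\Delta$, universal $R$-matrix $\mathcal{R}$ and $\widetilde{\mathcal{R}}=\mathcal{R}_{21}$. Set $C_1=C\otimes1\otimes1$, $C_2=1\otimes C\otimes1$, $C_3=1\otimes1\otimes C$, $C_{12}=\Delta(C)\otimes1$, $C_{23}=1\otimes\Delta(C)$, $C_{123}=(\Delta\otimes\mathrm{id})\Delta(C)$, $C_{13}=C_{(1)}\otimes1\otimes C_{(2)}$ (where $\Delta(C)=C_{(1)}\otimes C_{(2)}$ in Sweedler notation), and $$C_{13}^{(0)}=\widetilde{\mathcal{R}}_{23}^{-1}\,C_{13}\,\widetilde{\mathcal{R}}_{23}=\mathcal{R}_{12}\,C_{13}\,\mathcal{R}_{12}^{-1},\qquad C_{13}^{(1)}=\widetilde{\mathcal{R}}_{12}^{-1}\,C_{13}\,\widetilde{\mathcal{R}}_{12}=\mathcal{R}_{23}\,C_{13}\,\mathcal{R}_{23}^{-1}.$$ Then, with $[A,B]_q=qAB-q^{-1}BA$, the following relations hold in $U^{\otimes3}$: $$\frac{1}{q-q^{-1}}[C_{13}^{(0)},C_{12}]_q=C_{23}+C_2C_3+C_1C_{123},$$ $$\frac{1}{q-q^{-1}}[C_{23},C_{13}^{(0)}]_q=C_{12}+C_1C_2+C_3C_{123},$$ $$\frac{1}{q-q^{-1}}[C_{23},C_{12}]_q=C_{13}^{(1)}+C_1C_3+C_2C_{123},$$ $$\frac{1}{q-q^{-1}}[C_{12},C_{13}^{(1)}]_q=C_{23}+C_2C_3+C_1C_{123},$$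 $$\frac{1}{q-q^{-1}}[C_{13}^{(1)},C_{23}]_q=C_{12}+C_1C_2+C_3C_{123}.$$
   Context: Let $q\in\mathbb{C}^*$ be not a root of unity (in particular $q\neq\pm1,\pm i$), with a fixed square root $q^{1/2}$. Write $[X]_q=\frac{q^X-q^{-X}}{q-q^{-1}}$, $[n]_q!=[n]_q[n-1]_q\cdots[1]_q$, $[0]_q!=1$. The algebra $U=U_q(\mathfrak{sl}_2)$ is the associative unital algebra over $\mathbb{C}$ generated by $E$, $F$ and the invertible element $q^{H}$ (with $q^{kH}=(q^H)^k$ for $k\in\mathbb{Z}$), with relations $q^HE=qEq^H$, $q^HF=q^{-1}Fq^H$, $[E,F]=[2H]_q=\frac{q^{2H}-q^{-2H}}{q-q^{-1}}$. The Casimir element, which is central, is $$C=-\frac{(q-q^{-1})^2}{q+q^{-1}}\left(FE+\frac{q\,q^{2H}+q^{-1}q^{-2H}}{(q-q^{-1})^2}\right).$$ The comultiplication is the algebra homomorphism $\Delta:U\to U\otimes U$ with $\Delta(E)=E\otimes q^{-H}+q^H\otimes E$, $\Delta(F)=F\otimes q^{-H}+q^H\otimes F$, $\Delta(q^H)=q^H\otimes q^H$; it is coassociative. The universal $R$-matrix and its flip are $$\mathcal{R}=q^{2(H\otimes H)}\sum_{n\ge0}\frac{(q-q^{-1})^n}{[n]_q!}q^{n(n-1)/2}(Eq^H\otimes q^{-H}F)^n,$$ $$\widetilde{\mathcal{R}}=\mathcal{R}_{21}=\sum_{n\ge0}\frac{(q-q^{-1})^n}{[n]_q!}q^{n(n-1)/2}(Fq^H\otimes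 q^{-H}E)^n\;q^{2(H\otimes H)}.$$ Here $\mathcal{R}_{12}=\mathcal{R}\otimes1$, $\mathcal{R}_{23}=1\otimes\mathcal{R}$, and similarly for $\widetilde{\mathcal{R}}$. The two expressions given for each of $C_{13}^{(0)}$ and $C_{13}^{(1)}$ are equal. Interpretation of the series: for $n\ge0$ let $V_n$ be the simple $U$-module of dimension $n+1$ whose highest weight vector has $q^H$-eigenvalue $q^{n/2}$; put $\widehat{U^{\otimes k}}=\prod_{n_1,\dots,n_k\ge0}\mathrm{End}(V_{n_1}\otimes\cdots\otimes V_{n_k})$. Since $q$ is not a root of unity, $U^{\otimes k}$ embeds in $\widehat{U^{\otimes k}}$ and is identified with its image. The operator $q^{2(H\otimes H)}$ acts on a tensor product of weight vectors with $q^H$-eigenvalues $q^{m}$, $q^{m'}$ ($m,m'\in\frac12\mathbb{Z}$) as multiplication by $q^{2mm'}$, so $\mathcal{R}$ and $\widetilde{\mathcal{R}}$ are well-defined invertible elements of $\widehat{U^{\otimes 2}}$, and products with them are taken in $\widehat{U^{\otimes 3}}$. *)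

(* Defs.v *)
From HB Require Import structures.
From mathcomp Require Import all_boot all_order all_algebra.
From mathcomp Require Import boolp classical_sets.
From mathcomp Require Import reals.
From mathcomp Require Import complex mxtens.
From mathcomp Require Import zify ring.

Set Implicit Arguments.
Unset Strict Implicit.
Unset Printing Implicit Defensive.

Import GRing.Theory.

Local Open Scope ring_scope.
Local Open Scope quotient_scope.

Lemma exists_unital_functional (K : fieldType) (A : algType K) :
  exists2 f : A -> K, (forall k a b, f (k *: a + b) = k * f a + f b) & f 1 = 1.
Proof.
pose P := [set W : set A |
  (forall k a b, W a -> W b -> W (k *: a + b)) /\ ~ W 1]%classic.
have [|W [[Wlin W1] Wmax]] := @Zorn_bigcup _ P.
  move=> F FP Ftot; split=> [k a b [X FX Xa] [Y FY Yb]|[X FX X1]].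
    have [XY|YX] := Ftot _ _ FX FY.
      by exists Y => //; apply: (FP _ FY).1 => //; apply: XY.
    by exists X => //; apply: (FP _ FX).1 => //; apply: YX.
  exact: (FP _ FX).2.
have ext a : ~ W a -> exists w k, (W w \/ w = 0) /\ 1 = w + k *: a.
  move=> Wa; apply/not_existsP => no.
  pose B := [set x | exists w k, (W w \/ w = 0) /\ x = w + k *: a]%classic.
  apply: (Wmax B).
    split=> [w Ww|/(_ a) BW]; first by exists w, 0; rewrite scale0r addr0; split; [left|].
    by apply/Wa/BW; exists 0, 1; rewrite scale1r add0r; split; [right|].
  split=> [k _ _ [w [l [Ww ->]]] [w' [l' [Ww' ->]]]|[w [k Bw]]]; last first.
    by apply: (no w); exists k.
  exists (k *: w + w'), (k * l + l'); split; last first.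
    by rewrite scalerDr scalerA scalerDl addrACA.
  case: Ww Ww' => [Ww|->] [Ww'|->]; rewrite ?scaler0 ?add0r.
  - by left; apply: Wlin.
  - have W0 : W 0 by rewrite -[0](addNr w) -scaleN1r; apply: Wlin.
    by left; apply: Wlin.
  - by left.
  - by right.
have W0 : W 0.
  apply: contrapT => W0; have [w [k [[Ww|->]]]] := ext _ W0.
    by rewrite scaler0 addr0 => e; apply: W1; rewrite e.
  by rewrite scaler0 addr0 => /eqP; rewrite oner_eq0.
have WZ k a : W a -> W (k *: a) by move=> Wa; rewrite -[k *: a]addr0; apply: Wlin.
have WD a b : W a -> W b -> W (a + b) by move=> Wa; rewrite -[a]scale1r; apply: Wlin.
have Wc c : W (c *: 1) -> c = 0.
  move=> Wc; apply/eqP/negPn/negP => c0; apply: W1.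
  by rewrite -[1]scale1r -(mulVf c0) -scalerA; apply: WZ.
have Wuniq a c d : W (a - c *: 1) -> W (a - d *: 1) -> c = d.
  move=> Wac Wad; apply/esym/subr0_eq/Wc.
  have -> : (d - c) *: (1 : A) = (-1) *: (a - d *: 1) + (a - c *: 1).
    by rewrite scalerBl scaleN1r opprB addrA subrK.
  exact: Wlin.
have Wex a : exists c, W (a - c *: 1).
  have [Wa|/ext [w [k [Ww e]]]] := pselect (W a).
    by exists 0; rewrite scale0r subr0.
  have {}Ww : W w by case: Ww => [//|->].
  have k0 : k != 0.
    by apply/eqP => k0; apply: W1; rewrite e k0 scale0r addr0.
  exists k^-1; rewrite e scalerDr scalerA mulVf // scale1r opprD addrA addrAC.
  by rewrite subrr add0r -scaleNr; apply: WZ.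
have [f Wf] := choice Wex; exists f => [k a b|]; last first.
  by apply: (Wuniq 1); rewrite ?scale1r ?subrr.
apply: (Wuniq (k *: a + b)); first exact: Wf.
rewrite scalerDl opprD -scalerA addrACA -scalerBr.
by apply: Wlin; apply: Wf.
Qed.

Section TensorProduct.
Variables (K : fieldType) (A B : algType K).

(* A list of pairs [:: (a1, b1); ...; (an, bn)] stands for the formal sum
   a1 ⊗ b1 + ... + an ⊗ bn; [tens_eq] is the congruence imposing bilinearity. *)
Inductive tens_eq : seq (A * B) -> seq (A * B) -> Prop :=
| tens_refl s : tens_eq s s
| tens_sym s t : tens_eq s t -> tens_eq t s
| tens_trans s t u : tens_eq s t -> tens_eq t u -> tens_eq s u
| tens_cat s s' t t' :
    tens_eq s s' -> tens_eq t t' -> tens_eq (s ++ t) (s' ++ t')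
| tens_catC s t : tens_eq (s ++ t) (t ++ s)
| tens_addl a a' b : tens_eq [:: (a + a', b)] [:: (a, b); (a', b)]
| tens_addr a b b' : tens_eq [:: (a, b + b')] [:: (a, b); (a, b')]
| tens_scale k a b : tens_eq [:: (k *: a, b)] [:: (a, k *: b)]
| tens_zero b : tens_eq [:: (0, b)] [::].

Definition tens_eqb (s t : seq (A * B)) : bool := `[< tens_eq s t >].

Fact tens_eqb_refl : reflexive tens_eqb.
Proof. by move=> s; apply/asboolP; apply: tens_refl. Qed.

Fact tens_eqb_sym : symmetric tens_eqb.
Proof. by move=> s t; apply/asboolP/asboolP => /tens_sym. Qed.

Fact tens_eqb_trans : transitive tens_eqb.
Proof.
by move=> t s u /asboolP st /asboolP tu; apply/asboolP/(tens_trans st tu).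
Qed.

Canonical tens_equiv :=
  EquivRel tens_eqb tens_eqb_refl tens_eqb_sym tens_eqb_trans.

Definition tens : Type := {eq_quot tens_equiv}.

HB.instance Definition _ := Choice.on tens.
HB.instance Definition _ := EqQuotient.on tens.

Implicit Types (s t u : seq (A * B)) (x y z : tens).

Lemma tensW (P : tens -> Prop) : (forall s, P (\pi_tens s)) -> forall x, P x.
Proof. by move=> Ppi x; rewrite -[x]reprK. Qed.

Lemma tens_piP s t : tens_eq s t <-> \pi_tens s = \pi_tens t.
Proof.
split=> [st|/eqmodP /asboolP //].
by apply/eqmodP/asboolP.
Qed.

Lemma tens_repr s : tens_eq (repr (\pi_tens s)) s.
Proof. by apply/tens_piP; rewrite reprK. Qed.

Definition tens_add x y : tens := \pi_tens (repr x ++ repr y).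

Lemma tens_add_pi s t : tens_add (\pi_tens s) (\pi_tens t) = \pi_tens (s ++ t).
Proof. by apply/tens_piP/tens_cat; apply: tens_repr. Qed.

Lemma tens_map_eq (f g : A * B -> A * B) s :
  (forall p, tens_eq [:: f p] [:: g p]) -> tens_eq (map f s) (map g s).
Proof.
move=> fg; elim: s => [|p s IH] /=; first exact: tens_refl.
exact: (tens_cat (fg p) IH).
Qed.

Lemma tens_catAC s t u : tens_eq (s ++ t ++ u) (t ++ s ++ u).
Proof.
by rewrite !catA; apply: tens_cat; [apply: tens_catC|apply: tens_refl].
Qed.

Lemma tens_map_add (f g h : A * B -> A * B) s :
  (forall p, tens_eq [:: f p] [:: g p; h p]) ->
  tens_eq (map f s) (map g s ++ map h s).
Proof.
move=> fgh; elim: s => [|p s IH] /=; first exact: tens_refl.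
apply: (tens_trans (tens_cat (fgh p) IH)) => /=.
apply: (@tens_cat [:: g p] [:: g p]); first exact: tens_refl.
exact: (@tens_catAC [:: h p]).
Qed.

Lemma tens_map_nil (f : A * B -> A * B) s :
  (forall p, tens_eq [:: f p] [::]) -> tens_eq (map f s) [::].
Proof.
move=> f0; elim: s => [|p s IH] /=; first exact: tens_refl.
exact: (tens_cat (f0 p) IH).
Qed.

Lemma tens_eq_sum (M : lmodType K) (f : A -> B -> M) s t :
    (forall a a' b, f (a + a') b = f a b + f a' b) ->
    (forall a b b', f a (b + b') = f a b + f a b') ->
    (forall k a b, f (k *: a) b = k *: f a b) ->
    (forall k a b, f a (k *: b) = k *: f a b) ->
  tens_eq s t -> \sum_(p <- s) f p.1 p.2 = \sum_(p <- t) f p.1 p.2.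
Proof.
move=> fDl fDr fZl fZr.
elim=> {s t} [s|s t _ ->|s t u _ -> _ ->|s s' t t' _ e _ e'|s t|a a' b|a b b'|
             k a b|b] //.
- by rewrite !big_cat /= e e'.
- by rewrite !big_cat /= addrC.
- by rewrite !big_cons !big_nil !addr0 fDl.
- by rewrite !big_cons !big_nil !addr0 fDr.
- by rewrite !big_seq1 fZl fZr.
- by rewrite big_seq1 big_nil -(scale0r 0) fZl scale0r.
Qed.

(* For bilinear f this is the induced linear map: by [tens_eq_sum] the choice
   of representative is irrelevant. *)
Definition tens_lift (M : lmodType K) (f : A -> B -> M) x : M :=
  \sum_(p <- repr x) f p.1 p.2.

Definition tpure (a : A) (b : B) : tens := \pi_tens [:: (a, b)].

Fact tens_addA : associative tens_add.
Proof.
move=> x y z; elim/tensW: x => s; elim/tensW: y => t; elim/tensW: z => u.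
by rewrite !tens_add_pi catA.
Qed.

Fact tens_addC : commutative tens_add.
Proof.
move=> x y; elim/tensW: x => s; elim/tensW: y => t; rewrite !tens_add_pi.
exact/tens_piP/tens_catC.
Qed.

Definition tens_0 : tens := \pi_tens [::].

Fact tens_add0 : left_id tens_0 tens_add.
Proof. by move=> x; elim/tensW: x => s; rewrite tens_add_pi. Qed.

Definition tens_opp x : tens := \pi_tens [seq (- p.1, p.2) | p <- repr x].

Lemma tens_eq_mapl (h : A -> A) s t :
    {morph h : a a' / a + a'} -> (forall k a, h (k *: a) = k *: h a) ->
  tens_eq s t -> tens_eq [seq (h p.1, p.2) | p <- s] [seq (h p.1, p.2) | p <- t].
Proof.
move=> hD hZ.
elim=> {s t} [s|s t _|s t u _ st _|s s' t t' _ e _ e'|s t|a a' b|a b b'|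
             k a b|b] /=.
- exact: tens_refl.
- exact: tens_sym.
- exact: tens_trans.
- by rewrite !map_cat; apply: tens_cat.
- by rewrite !map_cat; apply: tens_catC.
- by rewrite hD; apply: tens_addl.
- exact: tens_addr.
- by rewrite hZ; apply: tens_scale.
- by rewrite -(scale0r 0) hZ scale0r; apply: tens_zero.
Qed.

Lemma tens_opp_pi s : tens_opp (\pi_tens s) = \pi_tens [seq (- p.1, p.2) | p <- s].
Proof.
apply/tens_piP/tens_eq_mapl; last exact: tens_repr.
  by move=> ? ?; rewrite opprD.
by move=> ? ?; rewrite scalerN.
Qed.

Fact tens_addN : left_inverse tens_0 tens_opp tens_add.
Proof.
move=> x; elim/tensW: x => s; rewrite tens_opp_pi tens_add_pi; apply/tens_piP.
rewrite -[X in _ ++ X]map_id; apply: tens_sym.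
apply: (tens_trans _ (@tens_map_add (fun p => (0, p.2)) _ _ _ _)).
  by apply/tens_sym/tens_map_nil=> p; apply: tens_zero.
by case=> a b /=; rewrite -(addNr a); apply: tens_addl.
Qed.

HB.instance Definition _ :=
  GRing.isZmodule.Build tens tens_addA tens_addC tens_add0 tens_addN.

Lemma tens_addE s t : \pi_tens s + \pi_tens t = \pi_tens (s ++ t).
Proof. exact: tens_add_pi. Qed.

Definition tens_scalar (k : K) x : tens :=
  \pi_tens [seq (k *: p.1, p.2) | p <- repr x].

Lemma tens_scalar_pi k s :
  tens_scalar k (\pi_tens s) = \pi_tens [seq (k *: p.1, p.2) | p <- s].
Proof.
apply/tens_piP/tens_eq_mapl; last exact: tens_repr.
  by move=> ? ?; rewrite scalerDr.
by move=> ? ?; rewrite !scalerA mulrC.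
Qed.

Fact tens_scalarA k l x :
  tens_scalar k (tens_scalar l x) = tens_scalar (k * l) x.
Proof.
elim/tensW: x => s; rewrite !tens_scalar_pi -map_comp.
by congr (\pi_tens _); apply: eq_map => p /=; rewrite scalerA.
Qed.

Fact tens_scalar1 : left_id 1 tens_scalar.
Proof.
move=> x; elim/tensW: x => s; rewrite tens_scalar_pi.
by congr (\pi_tens _); rewrite -[RHS]map_id; apply: eq_map => -[a b] /=; rewrite scale1r.
Qed.

Fact tens_scalarDr : right_distributive tens_scalar +%R.
Proof.
move=> k x y; elim/tensW: x => s; elim/tensW: y => t; rewrite tens_addE !tens_scalar_pi.
by rewrite tens_addE map_cat.
Qed.

Fact tens_scalarDl x : {morph tens_scalar^~ x : k l / k + l}.
Proof.
move=> k l; elim/tensW: x => s; rewrite !tens_scalar_pi tens_addE.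
apply/tens_piP/tens_map_add => p; rewrite scalerDl; exact: tens_addl.
Qed.

HB.instance Definition _ := GRing.Zmodule_isLmodule.Build K tens
  tens_scalarA tens_scalar1 tens_scalarDr tens_scalarDl.

Definition tens_mul_seq s t := [seq (p.1 * r.1, p.2 * r.2) | p <- s, r <- t].

Lemma tens_mul_seql s s' t :
  tens_eq s s' -> tens_eq (tens_mul_seq s t) (tens_mul_seq s' t).
Proof.
rewrite /tens_mul_seq.
elim=> {s s'} [s|s s' _|s s' u _ st _|s s' u u' _ e _ e'|s u|a a' b|a b b'|
             k a b|b] /=; rewrite ?cats0.
- exact: tens_refl.
- exact: tens_sym.
- exact: tens_trans.
- by rewrite !allpairs_cat; apply: tens_cat.
- by rewrite !allpairs_cat; apply: tens_catC.
- by apply: tens_map_add => r; rewrite mulrDl; apply: tens_addl.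
- by apply: tens_map_add => r; rewrite mulrDl; apply: tens_addr.
- by apply: tens_map_eq => r; rewrite -!scalerAl; apply: tens_scale.
- by apply: tens_map_nil => r; rewrite mul0r; apply: tens_zero.
Qed.

Lemma tens_mul_seqr s t t' :
  tens_eq t t' -> tens_eq (tens_mul_seq s t) (tens_mul_seq s t').
Proof.
move=> tt'; elim: s => [|[c d] s IH] /=; first exact: tens_refl.
apply: (@tens_cat (map _ t) (map _ t')) IH => /=.
elim: tt' => {t t' s} [s|s t _|s t u _ st _|s s' t t' _ e _ e'|s t|a a' b|a b b'|
             k a b|b] /=.
- exact: tens_refl.
- exact: tens_sym.
- exact: tens_trans.
- by rewrite !map_cat; apply: tens_cat.
- by rewrite !map_cat; apply: tens_catC.
- by rewrite mulrDr; apply: tens_addl.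
- by rewrite mulrDr; apply: tens_addr.
- by rewrite -!scalerAr; apply: tens_scale.
- by rewrite mulr0; apply: tens_zero.
Qed.

Definition tens_mul x y : tens := \pi_tens (tens_mul_seq (repr x) (repr y)).

Lemma tens_mul_pi s t : tens_mul (\pi_tens s) (\pi_tens t) = \pi_tens (tens_mul_seq s t).
Proof.
apply/tens_piP.
by apply: (tens_trans (tens_mul_seql _ (tens_repr s)))
          (tens_mul_seqr _ (tens_repr t)).
Qed.

Fact tens_mulA : associative tens_mul.
Proof.
move=> x y z; elim/tensW: x => s; elim/tensW: y => t; elim/tensW: z => u.
rewrite !tens_mul_pi; congr (\pi_tens _).
rewrite /tens_mul_seq.
elim: s => //= p s ->; rewrite allpairs_cat; congr (_ ++ _).
elim: t => //= r t IH; rewrite map_cat IH -!map_comp; congr (_ ++ _).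
by apply: eq_map => w /=; rewrite !mulrA.
Qed.

Fact tens_1mul : left_id (tpure 1 1) tens_mul.
Proof.
move=> x; elim/tensW: x => s; rewrite /tpure tens_mul_pi /tens_mul_seq /= cats0.
by congr (\pi_tens _); rewrite -[RHS]map_id; apply: eq_map => -[a b] /=; rewrite !mul1r.
Qed.

Fact tens_mul1 : right_id (tpure 1 1) tens_mul.
Proof.
move=> x; elim/tensW: x => s; rewrite /tpure tens_mul_pi /tens_mul_seq; congr (\pi_tens _).
by elim: s => //= -[a b] s ->; rewrite !mulr1.
Qed.

Fact tens_mulDl : left_distributive tens_mul +%R.
Proof.
move=> x y z; elim/tensW: x => s; elim/tensW: y => t; elim/tensW: z => u.
rewrite [in LHS]tens_addE !tens_mul_pi tens_addE.
by rewrite /tens_mul_seq allpairs_cat.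
Qed.

Fact tens_mulDr : right_distributive tens_mul +%R.
Proof.
move=> x y z; elim/tensW: x => s; elim/tensW: y => t; elim/tensW: z => u.
rewrite [in LHS]tens_addE !tens_mul_pi tens_addE.
apply/tens_piP; rewrite /tens_mul_seq; elim: s => [|p s IH] /=; first exact: tens_refl.
rewrite map_cat -!catA; apply: tens_cat; first exact: tens_refl.
apply: (tens_trans (tens_cat (tens_refl _) IH)).
exact: tens_catAC.
Qed.

Fact tens_one_neq0 : tpure 1 1 != 0 :> tens.
Proof.
have [f flin f1] := exists_unital_functional A.
have [g glin g1] := exists_unital_functional B.
have f0 : f 0 = 0 by have := flin (-1) 0 0; rewrite scaler0 addr0 mulN1r addNr.
have g0 : g 0 = 0 by have := glin (-1) 0 0; rewrite scaler0 addr0 mulN1r addNr.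
apply/eqP => /tens_piP e.
have := @tens_eq_sum K^o (fun a b => f a * g b) _ _ _ _ _ _ e.
rewrite big_seq1 big_nil /= f1 g1 mulr1 => H.
case/eqP: (oner_neq0 K); apply: H => [a a' b|a b b'|k a b|k a b].
- by rewrite -[a]scale1r flin mul1r scale1r mulrDl.
- by rewrite -[b]scale1r glin mul1r scale1r mulrDr.
- by rewrite -[k *: a]addr0 flin f0 addr0 -mulrA.
- by rewrite -[k *: b]addr0 glin g0 addr0 mulrCA.
Qed.

HB.instance Definition _ := GRing.Zmodule_isNzRing.Build tens
  tens_mulA tens_1mul tens_mul1 tens_mulDl tens_mulDr tens_one_neq0.

Fact tens_scalerAl k x y : k *: (x * y) = (k *: x) * y.
Proof.
elim/tensW: x => s; elim/tensW: y => t.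
rewrite /GRing.mul /GRing.scale /= tens_mul_pi !tens_scalar_pi tens_mul_pi.
congr (\pi_tens _); rewrite /tens_mul_seq.
elim: s => //= p s <-; rewrite map_cat -!map_comp; congr (_ ++ _).
by apply: eq_map => r /=; rewrite scalerAl.
Qed.

HB.instance Definition _ := GRing.Lmodule_isLalgebra.Build K tens tens_scalerAl.

Fact tens_scalerAr k x y : k *: (x * y) = x * (k *: y).
Proof.
elim/tensW: x => s; elim/tensW: y => t.
rewrite /GRing.mul /GRing.scale /= tens_mul_pi !tens_scalar_pi tens_mul_pi.
congr (\pi_tens _); rewrite /tens_mul_seq.
elim: s => //= p s <-; rewrite map_cat -!map_comp; congr (_ ++ _).
by apply: eq_map => r /=; rewrite scalerAr.
Qed.

HB.instance Definition _ := GRing.Lalgebra_isAlgebra.Build K tens tens_scalerAr.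

End TensorProduct.

Arguments tpure {K A B} a b.
Arguments tens_lift {K A B M} f x.

Notation "a ⊗ b" := (tpure a b) (at level 40, left associativity) : ring_scope.

Section TensorTheory.
Variables (K : fieldType) (A B : algType K).
Implicit Types (a : A) (b : B).

Lemma tpureDl a a' b : (a + a') ⊗ b = a ⊗ b + a' ⊗ b.
Proof. by rewrite tens_addE; apply/tens_piP/tens_addl. Qed.

Lemma tpureDr a b b' : a ⊗ (b + b') = a ⊗ b + a ⊗ b'.
Proof. by rewrite tens_addE; apply/tens_piP/tens_addr. Qed.

Lemma tpureZl k a b : (k *: a) ⊗ b = k *: (a ⊗ b).
Proof. by rewrite [RHS]tens_scalar_pi. Qed.

Lemma tpureZr k a b : a ⊗ (k *: b) = k *: (a ⊗ b).
Proof. by rewrite -tpureZl; apply/esym/tens_piP/tens_scale. Qed.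

Lemma tpureM a a' b b' : (a ⊗ b) * (a' ⊗ b') = (a * a') ⊗ (b * b').
Proof. exact: tens_mul_pi. Qed.

Lemma tpure1 : 1 ⊗ 1 = 1 :> tens A B.
Proof. by []. Qed.

Lemma tens_sum_pure (x : tens A B) : x = \sum_(p <- repr x) p.1 ⊗ p.2.
Proof.
rewrite -{1}[x]reprK; elim: (repr x) => [|[a b] s IH]; first by rewrite big_nil.
by rewrite big_cons -IH tens_addE.
Qed.

Section Lift.
Variables (M : lmodType K) (f : A -> B -> M).
Hypothesis fDl : forall a a' b, f (a + a') b = f a b + f a' b.
Hypothesis fDr : forall a b b', f a (b + b') = f a b + f a b'.
Hypothesis fZl : forall k a b, f (k *: a) b = k *: f a b.
Hypothesis fZr : forall k a b, f a (k *: b) = k *: f a b.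

Lemma tens_lift_pi s : tens_lift f (\pi_(tens A B) s) = \sum_(p <- s) f p.1 p.2.
Proof. exact/tens_eq_sum/tens_repr. Qed.

Lemma tens_lift_pure a b : tens_lift f (a ⊗ b) = f a b.
Proof. by rewrite tens_lift_pi big_seq1. Qed.

Lemma tens_lift_linear : linear (tens_lift f).
Proof.
move=> k x y; elim/tensW: x => s; elim/tensW: y => t.
rewrite [_ *: _]tens_scalar_pi tens_addE !tens_lift_pi big_cat big_map scaler_sumr.
by congr (_ + _); apply: eq_bigr => p _ /=; rewrite fZl.
Qed.

End Lift.

End TensorTheory.

Definition tens_map (K : fieldType) (A B A' B' : algType K)
    (f : A -> A') (g : B -> B') : tens A B -> tens A' B' :=
  tens_lift (fun a b => f a ⊗ g b).

Lemma tens_map_pure (K : fieldType) (A B A' B' : algType K)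
    (f : {linear A -> A'}) (g : {linear B -> B'}) a b :
  tens_map f g (a ⊗ b) = f a ⊗ g b.
Proof.
apply: tens_lift_pure => *.
- by rewrite linearD tpureDl.
- by rewrite linearD tpureDr.
- by rewrite linearZ tpureZl.
- by rewrite linearZ tpureZr.
Qed.

Section QuantumSl2.
Variables (K : fieldType) (q : K).

(* Noncommutative polynomial expressions in E, F, q^H and q^{-H}. *)
Inductive uexpr :=
| XE | XF | XK | XKi
| XC of K
| XAdd of uexpr & uexpr
| XMul of uexpr & uexpr.

(* The smallest congruence containing the axioms of unital associative
   K-algebras and the defining relations of U_q(sl_2). *)
Inductive ueq : uexpr -> uexpr -> Prop :=
| ueq_refl x : ueq x x
| ueq_sym x y : ueq x y -> ueq y x
| ueq_trans x y z : ueq x y -> ueq y z -> ueq x z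
| ueq_add x x' y y' : ueq x x' -> ueq y y' -> ueq (XAdd x y) (XAdd x' y')
| ueq_mul x x' y y' : ueq x x' -> ueq y y' -> ueq (XMul x y) (XMul x' y')
| ueq_addA x y z : ueq (XAdd x (XAdd y z)) (XAdd (XAdd x y) z)
| ueq_addC x y : ueq (XAdd x y) (XAdd y x)
| ueq_add0 x : ueq (XAdd (XC 0) x) x
| ueq_mulA x y z : ueq (XMul x (XMul y z)) (XMul (XMul x y) z)
| ueq_1mul x : ueq (XMul (XC 1) x) x
| ueq_mul1 x : ueq (XMul x (XC 1)) x
| ueq_0mul x : ueq (XMul (XC 0) x) (XC 0)
| ueq_mulDl x y z : ueq (XMul (XAdd x y) z) (XAdd (XMul x z) (XMul y z))
| ueq_mulDr x y z : ueq (XMul x (XAdd y z)) (XAdd (XMul x y) (XMul x z))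
| ueq_constD k l : ueq (XC (k + l)) (XAdd (XC k) (XC l))
| ueq_constM k l : ueq (XC (k * l)) (XMul (XC k) (XC l))
| ueq_constC k x : ueq (XMul (XC k) x) (XMul x (XC k))
| ueq_KKi : ueq (XMul XK XKi) (XC 1)
| ueq_KiK : ueq (XMul XKi XK) (XC 1)
| ueq_KE : ueq (XMul XK XE) (XMul (XC q) (XMul XE XK))
| ueq_KF : ueq (XMul XK XF) (XMul (XC q^-1) (XMul XF XK))
| ueq_EF : ueq (XAdd (XMul XE XF) (XMul (XC (-1)) (XMul XF XE)))
    (XMul (XC (q - q^-1)^-1)
       (XAdd (XMul XK XK) (XMul (XC (-1)) (XMul XKi XKi)))).

HB.instance Definition _ := gen_eqMixin uexpr.
HB.instance Definition _ := gen_choiceMixin uexpr.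

Definition ueqb (x y : uexpr) : bool := `[< ueq x y >].

Fact ueqb_refl : reflexive ueqb.
Proof. by move=> x; apply/asboolP; apply: ueq_refl. Qed.

Fact ueqb_sym : symmetric ueqb.
Proof. by move=> x y; apply/asboolP/asboolP => /ueq_sym. Qed.

Fact ueqb_trans : transitive ueqb.
Proof.
by move=> y x z /asboolP xy /asboolP yz; apply/asboolP/(ueq_trans xy yz).
Qed.

Canonical ueq_equiv := EquivRel ueqb ueqb_refl ueqb_sym ueqb_trans.

Definition Uq : Type := {eq_quot ueq_equiv}.

HB.instance Definition _ := Choice.on Uq.
HB.instance Definition _ := EqQuotient.on Uq.

Lemma UqW (P : Uq -> Prop) : (forall e, P (\pi_Uq e)) -> forall x, P x.
Proof. by move=> Ppi x; rewrite -[x]reprK. Qed.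

Lemma Uq_piP e e' : ueq e e' <-> \pi_Uq e = \pi_Uq e'.
Proof.
split=> [ee'|/eqmodP /asboolP //].
by apply/eqmodP/asboolP.
Qed.

Lemma Uq_repr e : ueq (repr (\pi_Uq e)) e.
Proof. by apply/Uq_piP; rewrite reprK. Qed.

Definition Uq_add (x y : Uq) : Uq := \pi_Uq (XAdd (repr x) (repr y)).
Definition Uq_mul (x y : Uq) : Uq := \pi_Uq (XMul (repr x) (repr y)).
Definition Uq_const (k : K) : Uq := \pi_Uq (XC k).
Definition Uq_opp (x : Uq) : Uq := Uq_mul (Uq_const (-1)) x.

Lemma Uq_add_pi e e' : Uq_add (\pi_Uq e) (\pi_Uq e') = \pi_Uq (XAdd e e').
Proof. by apply/Uq_piP/ueq_add; apply: Uq_repr. Qed.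

Lemma Uq_mul_pi e e' : Uq_mul (\pi_Uq e) (\pi_Uq e') = \pi_Uq (XMul e e').
Proof. by apply/Uq_piP/ueq_mul; apply: Uq_repr. Qed.

Fact Uq_addA : associative Uq_add.
Proof.
move=> x y z; elim/UqW: x => x; elim/UqW: y => y; elim/UqW: z => z.
by rewrite !Uq_add_pi; apply/Uq_piP/ueq_addA.
Qed.

Fact Uq_addC : commutative Uq_add.
Proof.
move=> x y; elim/UqW: x => x; elim/UqW: y => y.
by rewrite !Uq_add_pi; apply/Uq_piP/ueq_addC.
Qed.

Fact Uq_add0 : left_id (Uq_const 0) Uq_add.
Proof.
by move=> x; elim/UqW: x => x; rewrite Uq_add_pi; apply/Uq_piP/ueq_add0.
Qed.

Fact Uq_addN : left_inverse (Uq_const 0) Uq_opp Uq_add.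
Proof.
move=> x; elim/UqW: x => x; rewrite /Uq_opp Uq_mul_pi Uq_add_pi; apply/Uq_piP.
apply: (ueq_trans _ (ueq_0mul x)); rewrite -(addNr 1).
apply: (ueq_trans (ueq_add (ueq_refl _) (ueq_sym (ueq_1mul x)))).
apply: (ueq_trans (ueq_sym (ueq_mulDl _ _ _))); apply: ueq_mul (ueq_refl x).
exact: ueq_sym (ueq_constD _ _).
Qed.

HB.instance Definition _ :=
  GRing.isZmodule.Build Uq Uq_addA Uq_addC Uq_add0 Uq_addN.

Fact Uq_mulA : associative Uq_mul.
Proof.
move=> x y z; elim/UqW: x => x; elim/UqW: y => y; elim/UqW: z => z.
by rewrite !Uq_mul_pi; apply/Uq_piP/ueq_mulA.
Qed.

Fact Uq_1mul : left_id (Uq_const 1) Uq_mul.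
Proof.
by move=> x; elim/UqW: x => x; rewrite Uq_mul_pi; apply/Uq_piP/ueq_1mul.
Qed.

Fact Uq_mul1 : right_id (Uq_const 1) Uq_mul.
Proof.
by move=> x; elim/UqW: x => x; rewrite Uq_mul_pi; apply/Uq_piP/ueq_mul1.
Qed.

Fact Uq_mulDl : left_distributive Uq_mul Uq_add.
Proof.
move=> x y z; elim/UqW: x => x; elim/UqW: y => y; elim/UqW: z => z.
by rewrite !(Uq_mul_pi, Uq_add_pi); apply/Uq_piP/ueq_mulDl.
Qed.

Fact Uq_mulDr : right_distributive Uq_mul Uq_add.
Proof.
move=> x y z; elim/UqW: x => x; elim/UqW: y => y; elim/UqW: z => z.
by rewrite !(Uq_mul_pi, Uq_add_pi); apply/Uq_piP/ueq_mulDr.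
Qed.

Section Eval.
Variables (A : algType K) (e f k ki : A).

Fixpoint ueval (x : uexpr) : A :=
  match x with
  | XE => e
  | XF => f
  | XK => k
  | XKi => ki
  | XC c => c%:A
  | XAdd y z => ueval y + ueval z
  | XMul y z => ueval y * ueval z
  end.

Definition Uq_relations : Prop :=
  [/\ k * ki = 1, ki * k = 1, k * e = q *: (e * k), k * f = q^-1 *: (f * k)
    & e * f - f * e = (q - q^-1)^-1 *: (k ^+ 2 - ki ^+ 2)].

Lemma ueval_eq x y : Uq_relations -> ueq x y -> ueval x = ueval y.
Proof.
case=> kki kik ke kf ef; elim=> {x y} //=.
- by move=> x y z _ -> _ ->.
- by move=> x x' y y' _ -> _ ->.
- by move=> x x' y y' _ -> _ ->.
- by move=> x y z; rewrite addrA.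
- by move=> x y; rewrite addrC.
- by move=> x; rewrite scale0r add0r.
- by move=> x y z; rewrite mulrA.
- by move=> x; rewrite scale1r mul1r.
- by move=> x; rewrite scale1r mulr1.
- by move=> x; rewrite scale0r mul0r.
- by move=> x y z; rewrite mulrDl.
- by move=> x y z; rewrite mulrDr.
- by move=> c d; rewrite scalerDl.
- by move=> c d; rewrite -scalerAl mul1r scalerA.
- by move=> c x; rewrite -scalerAl mul1r -scalerAr mulr1.
- by rewrite kki scale1r.
- by rewrite kik scale1r.
- by rewrite -scalerAl mul1r.
- by rewrite -scalerAl mul1r.
- by rewrite -!scalerAl !mul1r !scaleN1r ef !expr2.
Qed.

(* When [Uq_relations] holds this is the algebra morphism sending E, F, q^H,
   q^{-H} to e, f, k, ki: by [ueval_eq] the choice of representative is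
   irrelevant. *)
Definition Uq_lift (x : Uq) : A := ueval (repr x).

Lemma Uq_lift_pi x : Uq_relations -> Uq_lift (\pi_Uq x) = ueval x.
Proof. by move=> rel; apply: ueval_eq rel (Uq_repr x). Qed.

End Eval.

Fact Uq_one_neq0 : Uq_const 1 != Uq_const 0.
Proof.
apply/eqP => /Uq_piP /(@ueval_eq K^o 0 0 1 1) /= H.
case/eqP: (oner_neq0 K); move: H; rewrite /GRing.scale /= mulr1 mul0r; apply.
by split; rewrite ?mulr1 ?mulr0 ?mul0r ?scaler0 ?subrr ?scaler0.
Qed.

HB.instance Definition _ := GRing.Zmodule_isNzRing.Build Uq
  Uq_mulA Uq_1mul Uq_mul1 Uq_mulDl Uq_mulDr Uq_one_neq0.

Definition Uq_scale (c : K) (x : Uq) : Uq := Uq_const c * x.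

Lemma Uq_constD c d : Uq_const (c + d) = Uq_const c + Uq_const d.
Proof. by rewrite [RHS]Uq_add_pi; apply/Uq_piP/ueq_constD. Qed.

Lemma Uq_constM c d : Uq_const (c * d) = Uq_const c * Uq_const d.
Proof. by rewrite [RHS]Uq_mul_pi; apply/Uq_piP/ueq_constM. Qed.

Lemma Uq_constC c x : Uq_const c * x = x * Uq_const c.
Proof.
by elim/UqW: x => x; rewrite [LHS]Uq_mul_pi [RHS]Uq_mul_pi; apply/Uq_piP/ueq_constC.
Qed.

Fact Uq_scaleA c d x : Uq_scale c (Uq_scale d x) = Uq_scale (c * d) x.
Proof. by rewrite /Uq_scale mulrA Uq_constM. Qed.

Fact Uq_scale1 : left_id 1 Uq_scale.
Proof. by move=> x; apply: Uq_1mul. Qed.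

Fact Uq_scaleDr : right_distributive Uq_scale +%R.
Proof. by move=> c x y; rewrite /Uq_scale mulrDr. Qed.

Fact Uq_scaleDl x : {morph Uq_scale^~ x : c d / c + d}.
Proof. by move=> c d; rewrite /Uq_scale Uq_constD mulrDl. Qed.

HB.instance Definition _ := GRing.Zmodule_isLmodule.Build K Uq
  Uq_scaleA Uq_scale1 Uq_scaleDr Uq_scaleDl.

Fact Uq_scaleAl c (x y : Uq) : c *: (x * y) = (c *: x) * y.
Proof. exact: mulrA. Qed.

HB.instance Definition _ := GRing.Lmodule_isLalgebra.Build K Uq Uq_scaleAl.

Fact Uq_scaleAr c (x y : Uq) : c *: (x * y) = x * (c *: y).
Proof. by rewrite /GRing.scale /= /Uq_scale !mulrA Uq_constC. Qed.

HB.instance Definition _ := GRing.Lalgebra_isAlgebra.Build K Uq Uq_scaleAr.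

Definition UE : Uq := \pi_Uq XE.
Definition UF : Uq := \pi_Uq XF.
Definition UK : Uq := \pi_Uq XK.
Definition UKi : Uq := \pi_Uq XKi.

End QuantumSl2.

Section QuantumSl2Theory.
Variables (K : fieldType) (q : K).

Lemma UKE_relations : Uq_relations q (UE q) (UF q) (UK q) (UKi q).
Proof.
have pM (x y : uexpr K) : \pi_(Uq q) (XMul x y) = \pi_(Uq q) x * \pi_(Uq q) y.
  by rewrite [RHS]Uq_mul_pi.
have pD (x y : uexpr K) : \pi_(Uq q) (XAdd x y) = \pi_(Uq q) x + \pi_(Uq q) y.
  by rewrite [RHS]Uq_add_pi.
have pC k (x : Uq q) : \pi_(Uq q) (XC k) * x = k *: x by [].
split.
- by rewrite -pM; apply/Uq_piP/ueq_KKi.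
- by rewrite -pM; apply/Uq_piP/ueq_KiK.
- by have /Uq_piP := ueq_KE q; rewrite !pM pC.
- by have /Uq_piP := ueq_KF q; rewrite !pM pC.
- by have /Uq_piP := ueq_EF q; rewrite !(pM, pD) !pC !scaleN1r !expr2.
Qed.

Section Lift.
Variables (A : algType K) (e f k ki : A).
Hypothesis rel : Uq_relations q e f k ki.

Local Notation lift := (@Uq_lift K q A e f k ki).

Lemma Uq_liftD : {morph lift : x y / x + y}.
Proof.
move=> x y; elim/UqW: x => x; elim/UqW: y => y.
by rewrite [_ + _]Uq_add_pi !Uq_lift_pi.
Qed.

Lemma Uq_liftM : {morph lift : x y / x * y}.
Proof.
move=> x y; elim/UqW: x => x; elim/UqW: y => y.
by rewrite [_ * _]Uq_mul_pi !Uq_lift_pi.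
Qed.

Lemma Uq_liftZ c x : lift (c *: x) = c *: lift x.
Proof.
elim/UqW: x => x; rewrite [_ *: _]Uq_mul_pi !Uq_lift_pi //=.
by rewrite -scalerAl mul1r.
Qed.

Lemma Uq_lift1 : lift 1 = 1.
Proof. by rewrite Uq_lift_pi //= scale1r. Qed.

Lemma Uq_liftE : lift (UE q) = e. Proof. exact: Uq_lift_pi. Qed.
Lemma Uq_liftF : lift (UF q) = f. Proof. exact: Uq_lift_pi. Qed.
Lemma Uq_liftK : lift (UK q) = k. Proof. exact: Uq_lift_pi. Qed.
Lemma Uq_liftKi : lift (UKi q) = ki. Proof. exact: Uq_lift_pi. Qed.

End Lift.

Definition casimir : Uq q :=
  - ((q - q^-1) ^+ 2 / (q + q^-1)) *:
    (UF q * UE q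
     + ((q - q^-1) ^+ 2)^-1 *: (q *: UK q ^+ 2 + q^-1 *: UKi q ^+ 2)).

Definition Delta : Uq q -> tens (Uq q) (Uq q) :=
  Uq_lift (UE q ⊗ UKi q + UK q ⊗ UE q) (UF q ⊗ UKi q + UK q ⊗ UF q)
          (UK q ⊗ UK q) (UKi q ⊗ UKi q).

(* Delta is a well-defined algebra morphism: [Uq_liftD] ... [Uq_liftKi] apply. *)
Lemma Delta_relations : q != 0 ->
  Uq_relations q (UE q ⊗ UKi q + UK q ⊗ UE q) (UF q ⊗ UKi q + UK q ⊗ UF q)
    (UK q ⊗ UK q) (UKi q ⊗ UKi q).
Proof.
move=> q0; have [kki kik ke kf ef] := UKE_relations.
set e := UE q in ke ef *; set f := UF q in kf ef *.
set k := UK q in kki kik ke kf ef *; set ki := UKi q in kki kik ef *.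
have kif : ki * f = q *: (f * ki).
  have <- : ki * (k * f) * ki = f * ki by rewrite mulrA kik mul1r.
  by rewrite kf -scalerAr -scalerAl scalerA mulfV // scale1r -!mulrA kki mulr1.
have kie : ki * e = q^-1 *: (e * ki).
  have <- : ki * (k * e) * ki = e * ki by rewrite mulrA kik mul1r.
  by rewrite ke -scalerAr -scalerAl scalerA mulVf // scale1r -!mulrA kki mulr1.
split.
- by rewrite tpureM kki.
- by rewrite tpureM kik.
- by rewrite mulrDr mulrDl !tpureM kki kik ke !tpureZl !tpureZr scalerDr.
- by rewrite mulrDr mulrDl !tpureM kki kik kf !tpureZl !tpureZr scalerDr.
have c1 : (k * f) ⊗ (e * ki) = (f * k) ⊗ (ki * e).
  by rewrite kf kie tpureZl tpureZr.
have c2 : (e * k) ⊗ (ki * f) = (k * e) ⊗ (f * ki).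
  by rewrite ke kif tpureZl tpureZr.
set w := (_ *: _) in ef.
have {}ef : e * f = f * e + w by rewrite -ef addrC subrK.
have shuffle (V : zmodType) (a b u v x y : V) :
    a + u + x + (y + (b + v)) - (a + y + (x + b)) = u + v.
  apply/eqP; rewrite subr_eq; apply/eqP.
  by rewrite (AC ((2*1)*(1*2)) ((2*6)*((1*4)*(3*5)))).
rewrite !mulrDr !mulrDl !tpureM c1 c2 ef tpureDl tpureDr shuffle /w.
rewrite tpureZl tpureZr -scalerDr !expr2 !tpureM; congr (_ *: _).
by rewrite tpureDl tpureDr -[- (ki * ki)]scaleN1r tpureZl tpureZr !scaleN1r addrC addrA subrK.
Qed.

End QuantumSl2Theory.

Section Representations.
Variables (K : fieldType) (q s : K).
Hypotheses (q0 : q != 0) (sE : s ^+ 2 = q).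

Definition qnum (n : nat) : K := (q ^+ n - q ^- n) / (q - q^-1).

Definition qfact (n : nat) : K := \prod_(1 <= i < n.+1) qnum i.

(* V_n has basis v_0, ..., v_n (column vectors), where v_i has
   q^H-eigenvalue q^(wt n i / 2) = s ^ wt n i,
   E v_i = [n - i + 1] v_(i-1) and F v_i = [i + 1] v_(i+1). *)
Definition wt (n i : nat) : int := n%:Z - (2 * i)%:Z.

Definition repE n : 'M[K]_n.+1 :=
  \matrix_(i, j) if j == i.+1 :> nat then qnum (n - i) else 0.
Definition repF n : 'M[K]_n.+1 :=
  \matrix_(i, j) if i == j.+1 :> nat then qnum i else 0.
Definition repK n : 'M[K]_n.+1 := diag_mx (\row_i s ^ wt n i).
Definition repKi n : 'M[K]_n.+1 := diag_mx (\row_i s ^ (- wt n i)).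

Definition rep n : Uq q -> 'M[K]_n.+1 :=
  Uq_lift (repE n) (repF n) (repK n) (repKi n).

Lemma rep_relations n : q - q^-1 != 0 ->
  Uq_relations q (repE n) (repF n) (repK n) (repKi n).
Proof.
move=> qq0.
have mE (X Y : 'M[K]_n.+1) : X * Y = X *m Y by [].
have s0 : s != 0 by apply: contraNneq q0 => s0; rewrite -sE s0 expr0n.
have su : s \is a GRing.unit by rewrite unitfE.
have wtS i : wt n i.+1 = wt n i - 2 by rewrite /wt mulnS PoszD opprD addrCA addrC.
have s2 : s ^ (2 : int) = q by rewrite -sE.
have qs : q^-1 = s ^ (- (2 : int)) by rewrite -s2 invr_expz.
split.
- apply/matrixP => i j; rewrite mE mul_diag_mx !mxE; case: eqP => [->|_].
    by rewrite mulr1n -expfzDr // subrr expr0z.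
  by rewrite mulr0n mulr0.
- apply/matrixP => i j; rewrite mE mul_diag_mx !mxE; case: eqP => [->|_].
    by rewrite mulr1n -expfzDr // addNr expr0z.
  by rewrite mulr0n mulr0.
- apply/matrixP => i j; rewrite !mE mul_diag_mx mul_mx_diag !mxE.
  case: eqP => [->|_]; last by rewrite mulr0 mul0r mulr0.
  move: (qnum _) => c.
  by rewrite wtS -s2 [RHS]mulrCA -expfzDr // [2 + _]addrC subrK mulrC.
- apply/matrixP => i j; rewrite !mE mul_diag_mx mul_mx_diag !mxE.
  case: eqP => [->|_]; last by rewrite mulr0 mul0r mulr0.
  move: (qnum _) => c.
  by rewrite wtS qs [RHS]mulrCA -expfzDr // [- 2 + _]addrC mulrC.
apply/matrixP => i j; rewrite !expr2 !mE !mulmx_diag !mxE.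
have -> : \sum_k repE n i k * repF n k j =
    (i == j)%:R * (qnum (n - i) * qnum i.+1).
  have [i_n|i_n] := ltnP i n.
    rewrite (bigD1 (Ordinal (i_n : i.+1 < n.+1)%N)) //= big1 ?addr0.
      rewrite !mxE /= eqxx eqSS (inj_eq val_inj).
      by case: eqP => _; rewrite ?mul1r ?mul0r ?mulr0.
    move=> k; rewrite -val_eqE /= => /negPf ki.
    by rewrite !mxE ki mul0r.
  rewrite big1 => [|k _].
    have -> : (n - i)%N = 0%N by apply/eqP; rewrite subn_eq0.
    by rewrite /qnum !expr0 invr1 subrr mul0r mul0r mulr0.
  rewrite !mxE; case: eqP => [ki|_]; last by rewrite mul0r.
  by have := ltn_ord k; rewrite ki ltnS ltnNge i_n.
have -> : \sum_k repF n i k * repE n k j =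
    (i == j)%:R * (qnum i * qnum (n - i).+1).
  case: i => [[|i] lti] /=.
    rewrite big1 => [|k _]; last by rewrite !mxE /= mul0r.
    by rewrite /qnum !expr0 invr1 subrr !mul0r mulr0.
  rewrite (bigD1 (Ordinal (ltnW lti))) //= big1 ?addr0.
    rewrite !mxE /= eqxx -(inj_eq val_inj) /= eq_sym.
    have lein : (i < n)%N by rewrite -ltnS.
    by case: eqP => _; rewrite ?mul1r ?mul0r ?mulr0 // subnSK.
  move=> k; rewrite -val_eqE /= => /negPf ki.
  by rewrite !mxE /= eqSS eq_sym ki mul0r.
case: (i =P j) => [_|_]; last by rewrite !mul0r !mulr0n !subrr mulr0.
rewrite !mul1r !mulr1n.
have lein : (i <= n)%N by rewrite -ltnS.
have qz m : q ^+ m = s ^ (2 * m)%:Z by rewrite -sE -exprM.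
have -> : s ^ wt n i * s ^ wt n i = q ^+ (n - i) / q ^+ i.
  rewrite !qz invr_expz -!expfzDr //; congr (s ^ _).
  by rewrite /wt; move: lein; move: (nat_of_ord i) => m lemn; lia.
have -> : s ^ (- wt n i) * s ^ (- wt n i) = q ^+ i / q ^+ (n - i).
  rewrite !qz invr_expz -!expfzDr //; congr (s ^ _).
  by rewrite /wt; move: lein; move: (nat_of_ord i) => m lemn; lia.
have xi0 : q ^+ i != 0 by rewrite expf_neq0.
have yi0 : q ^+ (n - i) != 0 by rewrite expf_neq0.
rewrite /qnum !exprSr; move: (q ^+ i) (q ^+ (n - i)) xi0 yi0 => x y x0 y0.
have qq1 : q ^+ 2 - 1 != 0.
  by apply: contraNneq qq0 => e; rewrite -[q - q^-1](mulfK q0) mulrBl mulVf // -expr2 e mul0r.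
by field; rewrite ?x0 ?y0 ?q0 ?qq1.
Qed.

End Representations.

Notation Uq2 q := (tens (Uq q) (Uq q)).
Notation Uq3 q := (tens (tens (Uq q) (Uq q)) (Uq q)).

(* The completions of U ⊗ U and U ⊗ U ⊗ U: families of endomorphisms of
   V_a ⊗ V_b, resp. V_a ⊗ V_b ⊗ V_c, with [*t] the Kronecker product. *)
Definition hat2 (K : fieldType) := forall a b : nat, 'M[K]_(a.+1 * b.+1).
Definition hat3 (K : fieldType) :=
  forall a b c : nat, 'M[K]_(a.+1 * b.+1 * c.+1).

Definition hat3_mul (K : fieldType) (X Y : hat3 K) : hat3 K :=
  fun a b c => X a b c *m Y a b c.
Definition hat3_inv (K : fieldType) (X : hat3 K) : hat3 K :=
  fun a b c => invmx (X a b c).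

(* The cast in [leg23] reassociates V_a ⊗ (V_b ⊗ V_c). *)
Definition leg12 (K : fieldType) (X : hat2 K) : hat3 K :=
  fun a b c => X a b *t 1%:M.
Definition leg23 (K : fieldType) (X : hat2 K) : hat3 K :=
  fun a b c => castmx (mulnA _ _ _, mulnA _ _ _) (1%:M *t X b c).

Section UniversalR.
Variables (K : fieldType) (q s : K).

(* The embeddings of U ⊗ U and U ⊗ U ⊗ U into their completions. *)
Definition iota2 (x : Uq2 q) : hat2 K :=
  fun a b => tens_lift (fun y z => rep s a y *t rep s b z) x.
Definition iota3 (x : Uq3 q) : hat3 K :=
  fun a b c => tens_lift (fun y z => iota2 y a b *t rep s c z) x.

(* q^(2 (H ⊗ H)): on v_i ⊗ v_j, 2 (wt a i / 2) (wt b j / 2) is half of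
   wt a i * wt b j, and s is the chosen square root of q. *)
Definition qHH : hat2 K := fun a b =>
  diag_mx (\row_r s ^ (wt a (mxtens_unindex r).1 * wt b (mxtens_unindex r).2)).

Definition Rcoef (n : nat) : K :=
  (q - q^-1) ^+ n / qfact q n * q ^+ (n * n.-1)./2.

Definition Rpartial (N : nat) (x : Uq2 q) : hat2 K := fun a b =>
  \sum_(n < N) Rcoef n *: iota2 x a b ^+ n.

(* On V_a ⊗ V_b the series stops at n = a for the two elements x used below
   (see [Rpartial_stable]). *)
Definition Rseries (x : Uq2 q) : hat2 K := fun a b => Rpartial a.+1 x a b.

Definition univR : hat2 K := fun a b =>
  qHH a b *m Rseries ((UE q * UK q) ⊗ (UKi q * UF q)) a b.

(* R_21; [univR_unit] and [univRt_unit] give invertibility. *)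
Definition univRt : hat2 K := fun a b =>
  Rseries ((UF q * UK q) ⊗ (UKi q * UE q)) a b *m qHH a b.

End UniversalR.

Section UniversalRTheory.
Variables (K : fieldType) (q s : K).
Hypotheses (q0 : q != 0) (qq0 : q - q^-1 != 0) (sE : s ^+ 2 = q).

Lemma iota2_pure (x y : Uq q) a b :
  iota2 s (x ⊗ y) a b = rep s a x *t rep s b y.
Proof.
have rela := rep_relations q0 sE a qq0; have relb := rep_relations q0 sE b qq0.
rewrite /iota2 tens_lift_pure // => [u v w|u v w|k u v|k u v].
- by rewrite /rep Uq_liftD //; apply/matrixP => i j; rewrite !mxE mulrDl.
- by rewrite /rep Uq_liftD //; apply/matrixP => i j; rewrite !mxE mulrDr.
- by rewrite /rep Uq_liftZ //; apply/matrixP => i j; rewrite !mxE mulrA.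
- by rewrite /rep Uq_liftZ //; apply/matrixP => i j; rewrite !mxE mulrCA.
Qed.

Lemma tensmxX m n (X : 'M[K]_m.+1) (Y : 'M[K]_n.+1) k :
  (X *t Y) ^+ k = X ^+ k *t Y ^+ k.
Proof.
elim: k => [|k IH].
  rewrite !expr0; apply/matrixP => i j.
  case: (mxtens_indexP i) => i1 i2; case: (mxtens_indexP j) => j1 j2.
  rewrite tensmxE !mxE (can_eq (@mxtens_indexK _ _)) xpair_eqE.
  by case: eqP => _; case: eqP => _ /=; rewrite ?mulr1 ?mul0r ?mulr0.
by rewrite exprS IH [LHS]tensmx_mul !exprS.
Qed.

Lemma nilp_up n (X : 'M[K]_n.+1) k :
  (forall i j : 'I_n.+1, j != i.+1 :> nat -> X i j = 0) -> (n < k)%N ->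
  X ^+ k = 0.
Proof.
move=> X0 nk.
have Xk m : forall i j : 'I_n.+1, j != (i + m)%N :> nat -> (X ^+ m) i j = 0.
  elim: m => [|m IH] i j ne.
    by rewrite expr0 mxE; move: ne; rewrite addn0 -val_eqE /= eq_sym => /negPf->.
  rewrite exprSr mxE big1 // => l _.
  have [e|ne'] := eqVneq (l : nat) (i + m)%N; last by rewrite IH ?mul0r.
  by rewrite X0 ?mulr0 // e -addnS.
apply/matrixP => i j; rewrite mxE Xk // neq_ltn.
by rewrite (leq_trans (ltn_ord j)) // (leq_trans nk) ?leq_addl.
Qed.

Lemma nilp_down n (X : 'M[K]_n.+1) k :
  (forall i j : 'I_n.+1, i != j.+1 :> nat -> X i j = 0) -> (n < k)%N ->
  X ^+ k = 0.
Proof.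
move=> X0 nk.
have H : X^T ^+ k = 0 by apply: nilp_up nk => i j ne; rewrite mxE X0.
apply: trmx_inj; rewrite trmx0 -H.
elim: k {nk H} => [|k IH]; first by rewrite !expr0 trmx1.
by rewrite exprS exprSr -IH [LHS]trmx_mul.
Qed.

Let xE := (UE q * UK q) ⊗ (UKi q * UF q).
Let xF := (UF q * UK q) ⊗ (UKi q * UE q).

Lemma iota2_xE_nilp a b n : (a < n)%N -> iota2 s xE a b ^+ n = 0.
Proof.
have rela := rep_relations q0 sE a qq0.
move=> an; rewrite iota2_pure tensmxX nilp_up ?tens0mx // => i j ne.
rewrite /rep Uq_liftM // Uq_liftE // Uq_liftK // [_ * _]mul_mx_diag !mxE.
by rewrite (negPf ne) mul0r.
Qed.

Lemma iota2_xF_nilp a b n : (a < n)%N -> iota2 s xF a b ^+ n = 0.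
Proof.
have rela := rep_relations q0 sE a qq0.
move=> an; rewrite iota2_pure tensmxX nilp_down ?tens0mx // => i j ne.
rewrite /rep Uq_liftM // Uq_liftF // Uq_liftK // [_ * _]mul_mx_diag !mxE.
by rewrite (negPf ne) mul0r.
Qed.

Lemma Rpartial_stable a b N : (a < N)%N ->
  Rpartial s N xE a b = Rseries s xE a b /\
  Rpartial s N xF a b = Rseries s xF a b.
Proof.
move=> aN; rewrite /Rseries /Rpartial.
suff H (X : 'M[K]_(a.+1 * b.+1)) : (forall n, (a < n)%N -> X ^+ n = 0) ->
    \sum_(n < N) Rcoef q n *: X ^+ n = \sum_(n < a.+1) Rcoef q n *: X ^+ n.
  by split; apply: H => n an; rewrite ?iota2_xE_nilp ?iota2_xF_nilp.
move=> X0; rewrite -!(big_mkord xpredT (fun n => Rcoef q n *: X ^+ n)).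
rewrite (big_cat_nat (n := a.+1)) /= ?leqW // [X in _ + X]big_nat_cond.
rewrite [X in _ + X]big1 ?addr0 // => n; rewrite andbT => /andP[an _].
by rewrite X0 ?scaler0.
Qed.

Lemma qHH_unit a b : qHH s a b \in unitmx.
Proof.
have s0 : s != 0 by apply: contraNneq q0 => s0; rewrite -sE s0 expr0n.
rewrite unitmxE det_diag unitfE; apply/prodf_neq0 => i _.
by rewrite mxE expfz_neq0.
Qed.

Lemma Rseries_unit (x : Uq2 q) a b :
    (forall n, (a < n)%N -> iota2 s x a b ^+ n = 0) ->
  Rseries s x a b \in unitmx.
Proof.
move=> X0; rewrite /Rseries /Rpartial; move: (iota2 s x a b) X0 => X X0.
rewrite big_ord_recl /= expr0.
have -> : Rcoef q 0 = 1 by rewrite /Rcoef /qfact big_geq // !expr0 invr1 !mulr1.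
rewrite scale1r.
set T := \sum_(i < a) Rcoef q (bump 0 i) *: X ^+ i.
have -> : \sum_(i < a) Rcoef q (bump 0 i) *: X ^+ bump 0 i = X * T.
  rewrite mulr_sumr; apply: eq_bigr => i _.
  by rewrite /bump leq0n add1n exprS; apply: scalemxAr.
have XT : GRing.comm X T.
  apply: commr_sum => i _.
  transitivity (Rcoef q (bump 0 i) *: (X * X ^+ i)).
    exact/esym/scalemxAr.
  by rewrite (commrX i (commr_refl X)); apply: scalemxAl.
have Nn : (- (X * T)) ^+ a.+1 = 0.
  by rewrite exprNn exprMn_comm // X0 // mul0r mulr0.
have := subrX1 (- (X * T)) a.+1; rewrite Nn sub0r -opprD mulNr => /oppr_inj.
by rewrite addrC => /esym /mulmx1_unit [].
Qed.

Lemma univR_unit a b : univR q s a b \in unitmx.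
Proof.
by rewrite unitmx_mul qHH_unit Rseries_unit // => n; apply: iota2_xE_nilp.
Qed.

Lemma univRt_unit a b : univRt q s a b \in unitmx.
Proof.
by rewrite unitmx_mul qHH_unit Rseries_unit // => n; apply: iota2_xF_nilp.
Qed.

End UniversalRTheory.

Section Casimirs.
Variables (K : fieldType) (q : K).

Definition C1 : Uq3 q := (casimir q ⊗ 1) ⊗ 1.
Definition C2 : Uq3 q := (1 ⊗ casimir q) ⊗ 1.
Definition C3 : Uq3 q := (1 ⊗ 1) ⊗ casimir q.
Definition C12 : Uq3 q := Delta (casimir q) ⊗ 1.
Definition C23 : Uq3 q := tens_map (fun x => 1 ⊗ x) id (Delta (casimir q)).
Definition C13 : Uq3 q := tens_map (fun x => x ⊗ 1) id (Delta (casimir q)).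
Definition C123 : Uq3 q := tens_map (@Delta K q) id (Delta (casimir q)).

Definition qcomm (x y : Uq3 q) : Uq3 q := q *: (x * y) - q^-1 *: (y * x).

End Casimirs.

(* Main.v *)
Require Import Defs.
From HB Require Import structures.
From mathcomp Require Import all_boot all_order all_algebra.
From mathcomp Require Import boolp.
From mathcomp Require Import reals complex mxtens.
From mathcomp Require Import ring.

(* In any algebra containing three commuting copies (legs) of U, put
   C_13^(0) = [C_12, C_23]_q / (q - q^-1) - C_1 C_3 - C_2 C_123, and C_13^(1)
   likewise from [C_23, C_12]_q.  As Delta(C) is a sum of four tensors whose
   second factors are C, q^{-2H}, q^{-H} E and F q^{-H}, the elements C_23, C_123
   and C_13^(0) are linear in these elements of the third leg while C_12 does not
   involve it; so the relation for [C_13^(0), C_12]_q amounts to polynomial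
   identities in U ⊗ U, the coefficients of C_13^(0) being explicit.  The same
   coefficients are the conjugates by R of the first factors of Delta(C), which
   gives C_13^(0) R_12 = R_12 C_13.  For these conjugates,
   R = q^{2 (H ⊗ H)} Theta(X) with X = E q^H ⊗ q^{-H} F, where Theta satisfies a
   q-exponential functional equation.  An automorphism and an antiautomorphism
   of U exchanging E and F deduce all remaining relations from these two. *)

Set Implicit Arguments.
Unset Strict Implicit.
Unset Printing Implicit Defensive.

Import GRing.Theory.
Local Open Scope ring_scope.

(** The R-matrix exists only in the completion, whereas C_13^(0) and C_13^(1) have to be elements of
    U^{⊗3}. Defining them by q-commutators puts them there; conjugation by R then becomes an
    equation X R = R Y, to be verified on each V_a ⊗ V_b ⊗ V_c. The same computations thus take
    place in U^{⊗3}, in matrix algebras and in opposite algebras, where the antiautomorphism takes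
    its values; this is why legs in an arbitrary algebra are used. The polynomial identities are
    noncommutative and have q as a parameter. They are decided by computation: words are rewritten
    to a normal form with coefficients in Z[q, q^-1]. On V_a ⊗ V_b the element X is nilpotent, so
    Theta(X) is a finite sum and its functional equation is a recurrence for the coefficients. *)

(** * The opposite algebra as a K-algebra *)

HB.instance Definition _ (K : pzRingType) (V : lmodType K) :=
  GRing.Lmodule.on V^c.

(* Without the [A^c] ascriptions the products are elaborated in [A]. *)
Lemma converse_scaleAl (K : fieldType) (A : algType K) (c : K) (x y : A^c) :
  c *: (x * y : A^c) = (c *: x : A^c) * y.
Proof. exact: (@scalerAr K A c y x). Qed.
HB.instance Definition _ (K : fieldType) (A : algType K) :=
  GRing.Lmodule_isLalgebra.Build K A^c (@converse_scaleAl K A).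

Lemma converse_scaleAr (K : fieldType) (A : algType K) (c : K) (x y : A^c) :
  c *: (x * y : A^c) = x * (c *: y : A^c).
Proof. exact: (@scalerAl K A c y x). Qed.
HB.instance Definition _ (K : fieldType) (A : algType K) :=
  GRing.Lalgebra_isAlgebra.Build K A^c (@converse_scaleAr K A).

(** * Deciding identities in two commuting copies of U_q(sl_2) *)

Section Normalization.

(** The Casimir is a letter of its own, so that both products of [Gx] and [Gf] can be eliminated: a
    reduced word of one leg is c^i k^j x^n or c^i k^j f^n with j in Z, [Gki] standing for the
    inverse of k. *)
Inductive gen := Gc | Gk | Gki | Gx | Gf.

Definition gen_code g : nat :=
  match g with Gc => 0 | Gk => 1 | Gki => 2 | Gx => 3 | Gf => 4 end.
Definition gen_decode n : gen :=
  match n with 0 => Gc | 1 => Gk | 2 => Gki | 3 => Gx | _ => Gf end.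
Lemma gen_codeK : cancel gen_code gen_decode. Proof. by case. Qed.
HB.instance Definition _ := Equality.copy gen (can_type gen_codeK).

Definition letter := (bool * gen)%type.
(* [(c, z, w)] stands for c q^z w. *)
Definition mono := (int * int * seq letter)%type.

Definition leg_rule (g h : gen) : option (seq (int * int * seq gen)) :=
  match g, h with
  | Gk, Gki | Gki, Gk => Some [:: (1, 0, [::])]
  | Gx, Gk => Some [:: (1, -1, [:: Gk; Gx])]
  | Gx, Gki => Some [:: (1, 1, [:: Gki; Gx])]
  | Gf, Gk => Some [:: (1, 1, [:: Gk; Gf])]
  | Gf, Gki => Some [:: (1, -1, [:: Gki; Gf])]
  | Gx, Gf =>
      Some [:: (1, 0, [:: Gc]); (1, -1, [:: Gk; Gk]); (1, 1, [:: Gki; Gki])]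
  | Gf, Gx =>
      Some [:: (1, 0, [:: Gc]); (1, 1, [:: Gk; Gk]); (1, -1, [:: Gki; Gki])]
  | Gc, _ => None
  | _, Gc => Some [:: (1, 0, [:: Gc; g])]
  | _, _ => None
  end.

(** The Boolean names the leg; letters of the leg [false] move to the left of those of the leg
    [true]. *)
Definition rule (a b : letter) : option (seq mono) :=
  if a.1 == b.1 then
    omap (map (fun m => (m.1, [seq (a.1, g) | g <- m.2]))) (leg_rule a.2 b.2)
  else if a.1 then Some [:: (1, 0, [:: b; a])] else None.

Definition scale_mono (c z : int) (m : mono) : mono :=
  (c * m.1.1, z + m.1.2, m.2).

(** The linear extension of [f] from words to polynomials. *)
Definition bind (f : seq letter -> seq mono) (p : seq mono) : seq mono :=
  flatten [seq map (scale_mono m.1.1 m.1.2) (f m.2) | m <- p].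

(* Rewrites [a :: w] for a reduced word [w]; running out of the fuel [n] only
   leaves the result unreduced. *)
Fixpoint insert (n : nat) (a : letter) (w : seq letter) : seq mono :=
  if n is n'.+1 then
    if w is b :: w' then
      if rule a b is Some p then
        bind (fun v => foldr (fun l => bind (insert n' l)) [:: (1, 0, w')] v) p
      else [:: (1, 0, a :: w)]
    else [:: (1, 0, [:: a])]
  else [:: (1, 0, a :: w)].

Definition insert_word (v w : seq letter) : seq mono :=
  foldr (fun l => bind (insert 100 l)) [:: (1, 0, w)] v.

Definition mul_poly (p r : seq mono) : seq mono :=
  bind (fun v => bind (insert_word v) r) p.

Definition coef_sum (k : int * seq letter) (p : seq mono) : int :=
  foldr (fun m s => if (m.1.2, m.2) == k then m.1.1 + s else s) 0 p.

(** Powers of q belong to the key under which terms are collected: q is an indeterminate here, and a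
    positive answer is valid for every nonzero q. *)
Fixpoint is_zero (n : nat) (p : seq mono) : bool :=
  if p is m :: p' then
    if n is n'.+1 then
      (coef_sum (m.1.2, m.2) p == 0) &&
      is_zero n' [seq m' <- p' | (m'.1.2, m'.2) != (m.1.2, m.2)]
    else false
  else true.

Inductive scalar := Sq | Sqi | Sm | Sp.

Inductive pexpr :=
| PV of letter
| P1
| PA of pexpr & pexpr
| PN of pexpr
| PM of pexpr & pexpr
| PS of scalar & pexpr.

Definition scalar_terms (d : scalar) : seq mono :=
  match d with
  | Sq => [:: (1, 1, [::])]
  | Sqi => [:: (1, -1, [::])]
  | Sm => [:: (1, 1, [::]); (-1, -1, [::])]
  | Sp => [:: (1, 1, [::]); (1, -1, [::])]
  end.

Fixpoint normalize (e : pexpr) : seq mono :=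
  match e with
  | PV a => [:: (1, 0, [:: a])]
  | P1 => [:: (1, 0, [::])]
  | PA e1 e2 => normalize e1 ++ normalize e2
  | PN e1 => map (scale_mono (-1) 0) (normalize e1)
  | PM e1 e2 => mul_poly (normalize e1) (normalize e2)
  | PS d e1 => bind (fun=> normalize e1) (scalar_terms d)
  end.

Definition decide_eq (e1 e2 : pexpr) : bool :=
  let p := normalize (PA e1 (PN e2)) in is_zero (size p) p.

Variables (K : fieldType) (q : K) (A : algType K) (env : letter -> A).
Hypothesis q0 : q != 0.

Definition eval_mono (m : mono) : A :=
  (m.1.1%:~R * q ^ m.1.2) *: \prod_(a <- m.2) env a.
Definition eval_poly (p : seq mono) : A := \sum_(m <- p) eval_mono m.

Definition eval_scalar (d : scalar) : K :=
  match d with Sq => q | Sqi => q^-1 | Sm => q - q^-1 | Sp => q + q^-1 end.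

Fixpoint eval (e : pexpr) : A :=
  match e with
  | PV a => env a
  | P1 => 1
  | PA e1 e2 => eval e1 + eval e2
  | PN e1 => - eval e1
  | PM e1 e2 => eval e1 * eval e2
  | PS d e1 => eval_scalar d *: eval e1
  end.

Hypothesis rule_sound : forall a b p,
  rule a b = Some p -> env a * env b = eval_poly p.

Lemma eval_poly_cat p r : eval_poly (p ++ r) = eval_poly p + eval_poly r.
Proof. by rewrite /eval_poly big_cat. Qed.

Lemma eval_poly1 w : eval_poly [:: (1, 0, w)] = \prod_(a <- w) env a.
Proof. by rewrite /eval_poly big_seq1 /eval_mono /= expr0z mulr1 scale1r. Qed.

Lemma eval_scale c z p :
  eval_poly (map (scale_mono c z) p) = (c%:~R * q ^ z) *: eval_poly p.
Proof.
rewrite /eval_poly big_map scaler_sumr; apply: eq_bigr => -[[c' z'] w] _.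
by rewrite /eval_mono /= scalerA intrM expfzDr // mulrACA.
Qed.

Lemma eval_bind f p (F : seq letter -> A) :
  (forall w, eval_poly (f w) = F w) ->
  eval_poly (bind f p) = \sum_(m <- p) (m.1.1%:~R * q ^ m.1.2) *: F m.2.
Proof.
move=> fF; elim: p => [|m p IH]; first by rewrite /eval_poly !big_nil.
by rewrite /bind /= eval_poly_cat eval_scale fF big_cons -IH.
Qed.

Lemma eval_bind_mul f p x :
  (forall w, eval_poly (f w) = x * \prod_(a <- w) env a) ->
  eval_poly (bind f p) = x * eval_poly p.
Proof.
move=> fx; rewrite (eval_bind p fx) mulr_sumr.
by apply: eq_bigr => m _; rewrite scalerAr.
Qed.

Lemma eval_insert n a w :
  eval_poly (insert n a w) = env a * \prod_(b <- w) env b.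
Proof.
elim: n a w => [|n IH] a w /=; first by rewrite eval_poly1 big_cons.
case: w => [|b w] /=; first by rewrite eval_poly1 big_seq1 big_nil mulr1.
case E: (rule a b) => [p|]; last by rewrite eval_poly1 big_cons.
rewrite (@eval_bind _ _ (fun v => \prod_(c <- v) env c * \prod_(c <- w) env c)).
  rewrite big_cons mulrA (rule_sound E) /eval_poly mulr_suml.
  by apply: eq_bigr => m _; rewrite scalerAl.
elim=> [|c v IHv] /=; first by rewrite eval_poly1 big_nil mul1r.
rewrite (@eval_bind_mul _ _ (env c)); last exact: IH.
by rewrite IHv big_cons mulrA.
Qed.

Local Arguments insert : simpl never.

Lemma eval_insert_word v w :
  eval_poly (insert_word v w) = \prod_(b <- v) env b * \prod_(b <- w) env b.
Proof.
elim: v => [|c v IHv] /=; first by rewrite eval_poly1 big_nil mul1r.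
rewrite (@eval_bind_mul _ _ (env c)); last exact: eval_insert.
by rewrite IHv big_cons mulrA.
Qed.

Lemma eval_mul_poly p r : eval_poly (mul_poly p r) = eval_poly p * eval_poly r.
Proof.
rewrite (@eval_bind _ _ (fun v => \prod_(b <- v) env b * eval_poly r)).
  rewrite [eval_poly p]/eval_poly mulr_suml.
  by apply: eq_bigr => m _; rewrite scalerAl.
by move=> v; apply: eval_bind_mul => w; apply: eval_insert_word.
Qed.

Lemma eval_normalize e : eval_poly (normalize e) = eval e.
Proof.
elim: e => [a||e1 IH1 e2 IH2|e1 IH1|e1 IH1 e2 IH2|d e1 IH1] /=.
- by rewrite eval_poly1 big_seq1.
- by rewrite eval_poly1 big_nil.
- by rewrite eval_poly_cat IH1 IH2.
- by rewrite eval_scale IH1 expr0z mulr1 scaleN1r.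
- by rewrite eval_mul_poly IH1 IH2.
rewrite (@eval_bind _ _ (fun=> eval e1)) => [|_ //]; rewrite -scaler_suml.
congr (_ *: _); case: d; rewrite ?big_seq1 ?big_cons ?big_nil /=;
  by rewrite ?expr1z ?mulN1r ?mul1r ?addr0.
Qed.

Lemma eval_coef_sum k p :
  \sum_(m <- p | (m.1.2, m.2) == k) eval_mono m =
  ((coef_sum k p)%:~R * q ^ k.1) *: \prod_(a <- k.2) env a.
Proof.
elim: p => [|m p IH]; first by rewrite big_nil mul0r scale0r.
rewrite big_cons /=; case: eqP => // <- in IH *.
by rewrite IH /= intrD mulrDl scalerDl.
Qed.

Lemma is_zero_eval n p : is_zero n p -> eval_poly p = 0.
Proof.
elim: n p => [|n IH] [|m p] //=; rewrite /eval_poly ?big_nil //.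
case/andP => /eqP c0 /IH p0.
rewrite (bigID (fun m' => (m'.1.2, m'.2) == (m.1.2, m.2))) eval_coef_sum /=.
rewrite c0 mul0r scale0r add0r big_cons eqxx /= -big_filter.
exact: p0.
Qed.

Lemma decide_eqP e1 e2 : decide_eq e1 e2 -> eval e1 = eval e2.
Proof.
by move/is_zero_eval/eqP; rewrite eval_normalize /= subr_eq0 => /eqP.
Qed.

End Normalization.

Section LegRules.
Variables (K : fieldType) (q : K) (A : algType K) (L : gen -> A).
Hypotheses (q0 : q != 0).
Local Notation c := (L Gc).
Local Notation k := (L Gk).
Local Notation ki := (L Gki).
Local Notation x := (L Gx).
Local Notation f := (L Gf).
Hypotheses (kki : k * ki = 1) (kik : ki * k = 1)
  (xk : x * k = q^-1 *: (k * x)) (fk : f * k = q *: (k * f))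
  (fx : f * x = c + q *: (k * k) + q^-1 *: (ki * ki))
  (xf : x * f = c + q^-1 *: (k * k) + q *: (ki * ki)).

(** The rules that move c to the left say that c is central. This follows from the other relations,
    since c is expressible both through f x and through x f. *)
Lemma leg_rule_sound g h p : leg_rule g h = Some p ->
  L g * L h =
  \sum_(m <- p) (m.1.1%:~R * q ^ m.1.2) *: \prod_(a <- m.2) L a.
Proof.
have move_ki a (y : A) : a != 0 -> y * k = a^-1 *: (k * y) ->
    y * ki = a *: (ki * y).
  move=> a0 yk; rewrite -[LHS]mul1r -kik -mulrA [k * _]mulrA.
  have -> : k * y = a *: (y * k) by rewrite yk scalerA mulfV ?scale1r.
  by rewrite -scalerAl -[y * k * ki]mulrA kki mulr1 -scalerAr.
have xki : x * ki = q *: (ki * x) by apply: move_ki.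
have fki : f * ki = q^-1 *: (ki * f).
  by apply: move_ki; rewrite ?invr_eq0 ?invrK.
have cE : c = f * x - q *: (k * k) - q^-1 *: (ki * ki).
  by rewrite fx [c + _ + _]addrAC !addrK.
have cE' : c = x * f - q^-1 *: (k * k) - q *: (ki * ki).
  by rewrite xf [c + _ + _]addrAC !addrK.
have kfx : k * (f * x) = f * x * k.
  by rewrite -[RHS]mulrA xk -scalerAr !mulrA fk -scalerAl scalerA mulVf ?scale1r.
have kc : k * c = c * k.
  rewrite cE !(mulrBl, mulrBr) kfx -!scalerAr -!scalerAl !mulrA.
  by rewrite kki -[ki * ki * k]mulrA kik mul1r mulr1.
have kic : ki * c = c * ki.
  by rewrite -[LHS]mulr1 -kki !mulrA -[ki * c * k]mulrA -kc !mulrA kik mul1r.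
have sq_comm a (y z : A) : a != 0 -> y * z = a^-1 *: (z * y) ->
    y * (a *: (z * z)) = a^-1 *: (z * z) * y.
  move=> a0 yz; rewrite -scalerAr mulrA yz -scalerAl -mulrA yz -scalerAr mulrA.
  by rewrite !scalerA mulfV ?mul1r -?scalerAl.
have sq_comm' a (y z : A) : a != 0 -> y * z = a *: (z * y) ->
    y * (a^-1 *: (z * z)) = a *: (z * z) * y.
  by move=> a0 yz; rewrite sq_comm ?invr_eq0 ?invrK.
(* The expression through f x is inserted on the left and the one through x f on the right: x (f x)
   = (x f) x, and the squares of k and ki match because moving x past them exchanges q and q^-1. *)
have xc : x * c = c * x.
  rewrite {1}cE cE' !(mulrBl, mulrBr) mulrA.
  by rewrite (sq_comm q) // (sq_comm' q).
have fc : f * c = c * f.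
  rewrite {1}cE' cE !(mulrBl, mulrBr) mulrA.
  by rewrite (sq_comm q) // (sq_comm' q).
case: g; case: h => //= -[<-]; rewrite ?big_cons ?big_nil /=;
  rewrite ?expr0z ?expr1z ?mul1r ?scale1r ?mulr1 ?addr0 ?exprN1 ?addrA //.
Qed.
End LegRules.

(** * Copies of U_q(sl_2) in an algebra *)

Inductive sl2_gen := GE | GF | GK | GKi.

(** A function of the generator, so that a morphism [f] carries the leg [l] to [f \o l]. *)
Definition leg (A : Type) := sl2_gen -> A.

Definition mkleg (A : Type) (e f k ki : A) : leg A := fun g =>
  match g with GE => e | GF => f | GK => k | GKi => ki end.

Definition leg_comm (A : pzRingType) (l l' : leg A) :=
  forall g h, l g * l' h = l' h * l g.

Section Legs.
Variables (K : fieldType) (q : K) (A : algType K).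
Implicit Types l : leg A.

Definition is_leg l := Uq_relations q (l GE) (l GF) (l GK) (l GKi).

Definition cas l : A :=
  - ((q - q^-1) ^+ 2 / (q + q^-1)) *:
    (l GF * l GE
     + ((q - q^-1) ^+ 2)^-1 *: (q *: l GK ^+ 2 + q^-1 *: l GKi ^+ 2)).

(** For commuting legs this is the leg of the composite of Delta with the morphism U ⊗ U -> A that
    [l] and [l'] define. *)
Definition comul l l' : leg A :=
  mkleg (l GE * l' GKi + l GK * l' GE) (l GF * l' GKi + l GK * l' GF)
        (l GK * l' GK) (l GKi * l' GKi).

(* Rescaling C by q + q^-1 and E by -(q - q^-1)^2 turns the relations of
   [leg_rule] and formula [delta_c] for the coproduct of C into ones with
   coefficients in Z[q, q^-1]. *)
Definition letter_of l (g : gen) : A :=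
  match g with
  | Gc => (q + q^-1) *: cas l
  | Gk => l GK
  | Gki => l GKi
  | Gx => - (q - q^-1) ^+ 2 *: l GE
  | Gf => l GF
  end.

Definition legs_env l1 l2 (a : letter) : A :=
  letter_of (if a.1 then l2 else l1) a.2.

Hypotheses (q0 : q != 0) (m0 : q - q^-1 != 0) (h0 : q + q^-1 != 0).

Section OneLeg.
Variable l : leg A.
Hypothesis rel : is_leg l.
Local Notation c := (letter_of l Gc).
Local Notation k := (letter_of l Gk).
Local Notation ki := (letter_of l Gki).
Local Notation x := (letter_of l Gx).
Local Notation f := (letter_of l Gf).

Lemma letter_kki : k * ki = 1. Proof. by case: rel. Qed.
Lemma letter_kik : ki * k = 1. Proof. by case: rel. Qed.
Lemma letter_xk : x * k = q^-1 *: (k * x).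
Proof.
case: rel => _ _ ke _ _.
by rewrite /= -scalerAl -scalerAr ke !scalerA mulrAC mulVf ?mul1r.
Qed.
Lemma letter_fk : f * k = q *: (k * f).
Proof. by case: rel => _ _ _ kf _ /=; rewrite kf scalerA mulfV ?scale1r. Qed.
(** The definition of C, cleared of denominators; only [letter_xf] uses the commutator of E and
    F. *)
Lemma letter_fx : f * x = c + q *: (k * k) + q^-1 *: (ki * ki).
Proof.
rewrite /= /cas scalerA mulrN mulrCA divff // mulr1 scalerDr scalerA mulNr.
by rewrite mulfV ?expf_neq0 // scaleN1r !expr2 -scalerAr -addrA subrK.
Qed.

Lemma letter_xf : x * f = c + q^-1 *: (k * k) + q *: (ki * ki).
Proof.
case: rel => _ _ _ _ ef.
have -> : x * f = f * x + (q^-1 - q) *: (k * k) + (q - q^-1) *: (ki * ki).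
  have {}ef : l GE * l GF = l GF * l GE
       + (q - q^-1)^-1 *: (k * k - ki * ki) by rewrite -!expr2 -ef addrC subrK.
  rewrite /= -!scalerAl -!scalerAr ef scalerDr scalerA expr2 mulNr mulfK //.
  rewrite -[q^-1 - q]opprB -addrA; congr (_ + _).
  by rewrite scalerBr !scaleNr opprK.
rewrite letter_fx !scalerBl (AC (3*2*2) (1*4*6*(2*5)*(3*7))) /=.
by rewrite !subrr !addr0.
Qed.

Lemma letter_rule_sound g h p : leg_rule g h = Some p ->
  letter_of l g * letter_of l h =
  \sum_(m <- p) (m.1.1%:~R * q ^ m.1.2) *: \prod_(a <- m.2) letter_of l a.
Proof.
exact: (leg_rule_sound q0 letter_kki letter_kik letter_xk letter_fk letter_fx
  letter_xf).
Qed.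

Lemma letter_comm (y : A) : (forall g, y * l g = l g * y) ->
  forall g, y * letter_of l g = letter_of l g * y.
Proof.
move=> yl; have cZ a z : GRing.comm y z -> GRing.comm y (a *: z).
  by rewrite /GRing.comm -scalerAr -scalerAl => ->.
case=> //=; apply: (cZ) => //; apply: (cZ); apply: commrD.
  by apply: commrM; apply: yl.
by apply: (cZ); apply: commrD; apply: (cZ); apply: commrX; apply: yl.
Qed.
End OneLeg.

Lemma legs_rule_sound l1 l2 a b p : is_leg l1 -> is_leg l2 -> leg_comm l1 l2 ->
  rule a b = Some p ->
  legs_env l1 l2 a * legs_env l1 l2 b = eval_poly q (legs_env l1 l2) p.
Proof.
move=> rel1 rel2 cm; case: a b => [i g] [j h]; rewrite /rule /=.
case: eqP => [<-|].
  case E: leg_rule => [r|] //= -[<-]; rewrite /legs_env /= /eval_poly big_map.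
  have reli : is_leg (if i then l2 else l1) by case: (i).
  rewrite (letter_rule_sound reli E); apply: eq_bigr => m _.
  by rewrite /eval_mono big_map.
case: i j => [] [] //= _ -[<-]; rewrite /eval_poly big_seq1 /eval_mono /=.
rewrite expr0z mulr1 scale1r !big_cons big_nil mulr1 /legs_env /=.
apply: letter_comm => h'; apply/esym; apply: letter_comm => g'.
by rewrite cm.
Qed.
End Legs.

(** Scalars are recognized by shape only: a difference is read as q - q^-1, a sum as q + q^-1, an
    inverse as q^-1, anything else as q. A wrong reading makes the final unification in [legs_ring]
    fail. *)
Ltac reify l1 l2 t :=
  lazymatch t with
  | ?a + ?b =>
      let a' := reify l1 l2 a in let b' := reify l1 l2 b in constr:(PA a' b')
  | - ?a => let a' := reify l1 l2 a in constr:(PN a')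
  | 1 => constr:(P1)
  | ?a * ?b =>
      let a' := reify l1 l2 a in let b' := reify l1 l2 b in constr:(PM a' b')
  | (_ - _) *: ?a => let a' := reify l1 l2 a in constr:(PS Sm a')
  | (_ + _) *: ?a => let a' := reify l1 l2 a in constr:(PS Sp a')
  | _^-1 *: ?a => let a' := reify l1 l2 a in constr:(PS Sqi a')
  | _ *: ?a => let a' := reify l1 l2 a in constr:(PS Sq a')
  | letter_of _ l1 ?g => constr:(PV (false, g))
  | letter_of _ l2 ?g => constr:(PV (true, g))
  end.

Ltac legs_ring q0 l1 l2 sound :=
  lazymatch goal with |- ?t = ?u =>
    let t' := reify l1 l2 t in let u' := reify l1 l2 u in
    exact: (decide_eqP q0 sound (e1 := t') (e2 := u') isT)
  end.

Lemma scaler_inj (K : fieldType) (V : lmodType K) (a : K) (u v : V) :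
  a != 0 -> a *: u = a *: v -> u = v.
Proof. by move=> a0 /(congr1 ( *:%R a^-1)); rewrite !scalerA mulVf // !scale1r. Qed.

(** * Polynomial identities for Delta(C) in two legs *)

Section TwoLegs.
Variables (K : fieldType) (q : K) (A : algType K) (l1 l2 : leg A).

Local Notation c1 := (letter_of q l1 Gc).
Local Notation k1 := (letter_of q l1 Gk).
Local Notation ki1 := (letter_of q l1 Gki).
Local Notation x1 := (letter_of q l1 Gx).
Local Notation f1 := (letter_of q l1 Gf).
Local Notation c2 := (letter_of q l2 Gc).
Local Notation k2 := (letter_of q l2 Gk).
Local Notation ki2 := (letter_of q l2 Gki).
Local Notation x2 := (letter_of q l2 Gx).
Local Notation f2 := (letter_of q l2 Gf).
Local Notation m := (q - q^-1).
Local Notation h := (q + q^-1).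

(* (q + q^-1) Delta(C), with every FE and EF eliminated in favour of C. *)
Definition delta_c : A :=
  c1 * (ki2 * ki2) + k1 * k1 * c2 + h *: (k1 * k1 * (ki2 * ki2))
  + f1 * k1 * (ki2 * x2) + k1 * x1 * (f2 * ki2).
(* R (y ⊗ 1) R^-1 for y = q^{2H}, q^H x and f q^H; see [R_KK], [R_KX], [R_FK].
   Together with C these y span the first tensor factors of [delta_c]. *)
Definition tauK : A := k1 * k1 + q^-1 *: (k1 * x1 * (f2 * k2)).
Definition tauE : A := k1 * x1 * (k2 * k2).
Definition tauF : A :=
  (f1 * k1 + k1 * k1 * (f2 * k2)) * (ki2 * ki2)
    * (1 + q^-1 *: (x1 * ki1 * (k2 * f2))) - ki1 * ki1 * (f2 * ki2).

Local Notation k12 := (k1 * k2).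
Local Notation x12 := (x1 * ki2 + k1 * x2).
Local Notation f12 := (f1 * ki2 + k1 * f2).

Lemma letter_comulx : letter_of q (comul l1 l2) Gx = x12.
Proof. by rewrite /= scalerDr -scalerAl -scalerAr. Qed.

Hypotheses (q0 : q != 0) (m0 : m != 0) (h0 : h != 0).
Hypotheses (rel1 : is_leg q l1) (rel2 : is_leg q l2) (cm : leg_comm l1 l2).

Let sound a b p := @legs_rule_sound K q A q0 m0 h0 l1 l2 a b p rel1 rel2 cm.

Local Ltac lring := legs_ring q0 l1 l2 sound.

Lemma comul_is_leg : is_leg q (comul l1 l2).
Proof.
(* Multiplying a relation that contains E by this scalar turns E into the letter x, after which
   [lring] applies. *)
have m20 : - m ^+ 2 != 0 by rewrite oppr_eq0 expf_neq0.
split.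
- change (k1 * k2 * (ki1 * ki2) = 1); lring.
- change (ki1 * ki2 * (k1 * k2) = 1); lring.
- apply: (scaler_inj m20); rewrite scalerAr scalerA mulrC -scalerA scalerAl.
  rewrite -/(letter_of q (comul l1 l2) Gx) letter_comulx.
  change (k1 * k2 * x12 = q *: (x12 * (k1 * k2))); lring.
- change (k1 * k2 * f12 = q^-1 *: (f12 * (k1 * k2))); lring.
apply: (scaler_inj m20); rewrite scalerBr scalerAl scalerAr.
rewrite -/(letter_of q (comul l1 l2) Gx) letter_comulx scalerA expr2 mulNr.
rewrite mulfK // scaleNr.
change (x12 * f12 - f12 * x12 =
  - (m *: (k1 * k2 * (k1 * k2) - ki1 * ki2 * (ki1 * ki2)))); lring.
Qed.

Lemma delta_cE : letter_of q (comul l1 l2) Gc = delta_c.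
Proof.
have /esym := letter_fx m0 h0 (comul l1 l2).
rewrite letter_comulx -addrA => /(canRL (addrK _)) ->; rewrite /delta_c.
change (f12 * x12 - (q *: (k12 * k12) + q^-1 *: (ki1 * ki2 * (ki1 * ki2))) =
  delta_c).
rewrite /delta_c; lring.
Qed.

Definition bracket (a : A) : A := q *: (delta_c * a) - q^-1 *: (a * delta_c).

(** The four [bracket] lemmas are the coefficients of c, q^{-2H}, q^{-H} x and f q^{-H} of a third
    leg in [C_12, C_23]_q. Here c1 comes from C_1 C_3 and the terms with c2 come from C_2 C_123; the
    remainder is the coefficient of C_13^(0). *)
Lemma bracket_KK :
  bracket (k2 * k2) = m *: (h *: tauK + c1 + c2 * (k12 * k12)).
Proof. rewrite /bracket /delta_c /tauK; lring. Qed.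

Lemma bracket_cKK : bracket (c2 + h *: (k2 * k2)) =
  m *: (h *: (c1 + h *: tauK) + c2 * (delta_c + h *: (k12 * k12))).
Proof. rewrite /bracket /delta_c /tauK; lring. Qed.

Lemma bracket_FK :
  bracket (f2 * k2) = m *: (h *: tauF + c2 * (f12 * k12)).
Proof. rewrite /bracket /delta_c /tauF; lring. Qed.

Lemma bracket_KX :
  bracket (k2 * x2) = m *: (h *: tauE + c2 * (k12 * x12)).
Proof. rewrite /bracket /delta_c /tauE; lring. Qed.

Definition cobracket (a : A) : A := q *: (a * delta_c) - q^-1 *: (delta_c * a).

(** The same four coefficients for [C_13^(0), C_12]_q: the terms with c1 come from C_1 C_123, the
    summand c2 from C_2 C_3, and the remainder from C_23. *)
Lemma cobracket_tauK :
  cobracket tauK = m *: (h *: (k2 * k2) + c2 + c1 * (k12 * k12)).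
Proof. rewrite /cobracket /delta_c /tauK; lring. Qed.

Lemma cobracket_ctauK : cobracket (c1 + h *: tauK) =
  m *: (h *: (c2 + h *: (k2 * k2)) + c1 * (delta_c + h *: (k12 * k12))).
Proof. rewrite /cobracket /delta_c /tauK; lring. Qed.

Lemma cobracket_tauF :
  cobracket tauF = m *: (h *: (f2 * k2) + c1 * (f12 * k12)).
Proof. rewrite /cobracket /delta_c /tauF; lring. Qed.

Lemma cobracket_tauE :
  cobracket tauE = m *: (h *: (k2 * x2) + c1 * (k12 * x12)).
Proof. rewrite /cobracket /delta_c /tauE; lring. Qed.
End TwoLegs.

(** * The series of the universal R-matrix *)

Lemma RcoefS (K : fieldType) (q : K) n :
  Rcoef q n.+1 = Rcoef q n * ((q - q^-1) / qnum q n.+1) * q ^+ n.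
Proof.
have -> : Rcoef q n.+1 = (q - q^-1) ^+ n.+1 / qfact q n.+1
    * q ^+ ((n * n.-1)./2 + n).
  by rewrite /Rcoef -!bin2 binS bin1.
rewrite /Rcoef /qfact big_nat_recr //= exprSr exprD invfM; ring.
Qed.

(** The factor [n+1] in the denominator cancels because 1 - q^{-2(n+1)} = q^{-(n+1)} (q - q^-1)
    [n+1]. *)
Lemma Rcoef_rec (K : fieldType) (q : K) n :
  q != 0 -> q - q^-1 != 0 -> qnum q n.+1 != 0 ->
  Rcoef q n.+1 * (1 - q ^- 2 ^+ n.+1) = (q - q^-1) ^+ 2 * q^-1 * Rcoef q n.
Proof.
move=> q0 m0 qn0; rewrite RcoefS.
have -> : 1 - q ^- 2 ^+ n.+1 = q ^- n.+1 * ((q - q^-1) * qnum q n.+1).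
  rewrite /qnum mulrC [_ * (_ / _)]mulrC divfK // mulrBl mulfV ?expf_neq0 //.
  by rewrite exprVn exprAC expr2 invfM.
have -> : q ^- n.+1 = q^-1 * (q ^+ n)^-1 by rewrite exprS invfM.
have : q ^+ n != 0 by rewrite expf_neq0.
move: (q ^+ n) (Rcoef q n) (qnum q n.+1) qn0 => x c N N0 x0.
rewrite -[(q - q^-1) / N]mulrC expr2; set m := q - q^-1.
transitivity (m * m * q^-1 * c * (x / x) * (N / N)); first by ring.
by rewrite !divff // !mulr1.
Qed.

Section Series.
Variables (K : fieldType) (q : K) (A : algType K) (X : A) (N : nat).
Hypotheses (q0 : q != 0) (m0 : q - q^-1 != 0).
Hypothesis qn0 : forall n, qnum q n.+1 != 0.
Hypothesis XN : X ^+ N = 0.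
Local Notation m := (q - q^-1).

(** Theta(t X). The parameter is there because moving Theta(X) past an element that q-commutes with
    X rescales the argument. *)
Definition Rsum (t : K) : A := \sum_(n < N) (Rcoef q n * t ^+ n) *: X ^+ n.

Let big_shift (F : nat -> A) :
  F N = 0 -> \sum_(n < N) F n = F 0%N + \sum_(n < N) F n.+1.
Proof.
by move=> FN; rewrite -(big_ord_recl N (fun i => F i)) big_ord_recr /= FN addr0.
Qed.

Lemma Rsum_skew (y : A) t : X * y = t *: (y * X) -> Rsum 1 * y = y * Rsum t.
Proof.
move=> Xy; have Xny n : X ^+ n * y = t ^+ n *: (y * X ^+ n).
  elim: n => [|n IH]; first by rewrite !expr0 scale1r mul1r mulr1.
  rewrite exprS -mulrA IH -scalerAr [X * (y * _)]mulrA Xy -scalerAl.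
  by rewrite scalerA -mulrA -exprSr.
rewrite mulr_suml mulr_sumr; apply: eq_bigr => n _.
by rewrite expr1n mulr1 -scalerAl Xny scalerA -scalerAr.
Qed.

(* The functional equation of the q-exponential: it makes conjugation by R
   polynomial. *)
Lemma Rsum_shift :
  Rsum (q ^- 2) = Rsum 1 - (m ^+ 2 * q^-1) *: (X * Rsum 1).
Proof.
apply/eqP; rewrite -subr_eq opprK; apply/eqP.
rewrite /Rsum mulr_sumr scaler_sumr.
(* The constant terms are split off; the shifted sums keep the range N because the term of degree N
   vanishes. *)
rewrite (big_shift (F := fun n => (Rcoef q n * q ^- 2 ^+ n) *: X ^+ n)) ?XN ?scaler0 //.
rewrite (big_shift (F := fun n => (Rcoef q n * 1 ^+ n) *: X ^+ n)) ?XN ?scaler0 //.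
rewrite !expr0 -addrA -big_split /=; congr (_ + _); apply: eq_bigr => n _.
rewrite -scalerAr scalerA -exprS -scalerDl !expr1n !mulr1; congr (_ *: _).
by rewrite -(Rcoef_rec q0 m0 (qn0 _)) mulrBr mulr1 addrC subrK.
Qed.

(** Meant for f = F q^H and u = q^{4H} in the first leg and g = q^{-H} F in the second. Unlike the
    other factors, this f does not q-commute with X; the correction stems from [E, F]. *)
Lemma Rsum_commutator (f g u : A) :
  X * f = q ^- 2 *: (f * X) + (q^-1 / m) *: (g * u - g) ->
  X * g = g * X -> X * u = q ^- 4 *: (u * X) ->
  Rsum 1 * f = f * Rsum (q ^- 2)
    + q^-1 *: (g * u * Rsum (q ^- 2) - g * Rsum 1).
Proof.
have -> : q ^- 4 = q ^- 2 * q ^- 2 :> K by rewrite -invfM -exprD.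
move: (erefl (q ^- 2)); rewrite {1}(_ : q ^- 2 = q^-1 * q^-1); last first.
  by rewrite expr2 invfM.
set t := q ^- 2; set r := q^-1 / m => tE Xf Xg Xu.
pose P n := g * u * X ^+ n; pose Q n := g * X ^+ n.
have XP n : X * P n = (t * t) *: P n.+1.
  by rewrite /P !mulrA Xg -[g * X * u]mulrA Xu -scalerAr -scalerAl exprS !mulrA.
have XQ n : X * Q n = Q n.+1 by rewrite /Q mulrA Xg -mulrA -exprS.
have XfX n : X * (f * X ^+ n) = t *: (f * X ^+ n.+1) + r *: P n - r *: Q n.
  rewrite mulrA Xf mulrDl -!scalerAl -mulrA -exprS mulrBl scalerBr addrA.
  by rewrite /P /Q.
(* Moving X^n past f creates one correction at each step. Since X passes [P] with a factor t^2 and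
   [Q] with none, the corrections add up to geometric sums in t. *)
pose b n : K := \sum_(j < n) t ^+ j.
have bS n : b n.+1 = b n + t ^+ n by rewrite /b big_ord_recr.
have bS' n : b n.+1 = 1 + t * b n.
  rewrite /b big_ord_recl expr0 mulr_sumr; congr (_ + _).
  by apply: eq_bigr => j _; rewrite -exprS.
have Xnf n : X ^+ n.+1 * f = t ^+ n.+1 *: (f * X ^+ n.+1)
    + (r * b n.+1 * t ^+ n) *: P n - (r * b n.+1) *: Q n.
  elim: n => [|n IH].
    by rewrite /b big_ord1 !expr1 !expr0 !mulr1 Xf /P /Q !expr0 !mulr1 scalerBr addrA.
  rewrite [in LHS]exprS -mulrA IH !(mulrDr, mulrN) -!scalerAr XP XQ XfX.
  rewrite !scalerDr !scalerN !scalerA (AC (3*1*1) (1*(2*4)*(3*5))) /=.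
  rewrite -opprD -!scalerDl -exprSr; congr (_ + _ *: _ - _ *: _).
    by rewrite [in RHS]bS' exprSr; ring.
  by rewrite [in RHS]bS; ring.
(* As (1 - t) b_{n+1} = 1 - t^{n+1}, multiplication by 1 - t = q^-1 (q - q^-1) reduces this to
   [Rcoef_rec]. *)
have bc n : Rcoef q n.+1 * (r * b n.+1) = q^-1 * Rcoef q n.
  have t1 : 1 - t = q^-1 * m by rewrite -tE mulrBr mulVf.
  apply: (mulIf (_ : 1 - t != 0)); first by rewrite t1 mulf_neq0 ?invr_eq0.
  have -> : Rcoef q n.+1 * (r * b n.+1) * (1 - t)
      = r * (Rcoef q n.+1 * (1 - t ^+ n.+1)).
    rewrite -[1 - t ^+ n.+1]opprB subrX1 -/(b n.+1).
    by move: (b n.+1) (Rcoef q n.+1) (t) (r) => B c t' r'; ring.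
  rewrite Rcoef_rec // t1 /r; move: (q^-1) (m) m0 (Rcoef q n) => p m' m'0 c.
  transitivity (p * p * m' * c * (m' / m')); first by ring.
  by rewrite divff // mulr1; ring.
have R1 : Rsum 1 = (Rcoef q 0 * 1 ^+ 0) *: X ^+ 0
    + \sum_(n < N) (Rcoef q n.+1 * 1 ^+ n.+1) *: X ^+ n.+1.
  apply: (big_shift (F := fun n => (Rcoef q n * 1 ^+ n) *: X ^+ n)).
  by rewrite XN scaler0.
rewrite {1}R1 mulrDl mulr_suml.
have -> : \sum_(i < N) (Rcoef q i.+1 * 1 ^+ i.+1) *: X ^+ i.+1 * f
  = \sum_(i < N) (Rcoef q i.+1 * t ^+ i.+1) *: (f * X ^+ i.+1)
    + q^-1 *: (g * u * Rsum t - g * Rsum 1).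
  rewrite /Rsum !mulr_sumr -sumrB scaler_sumr -big_split; apply: eq_bigr => n _.
  rewrite expr1n mulr1 -scalerAl Xnf !scalerDr scalerN !scalerA !expr1n mulr1.
  rewrite -!addrA; congr (_ + _).
  by rewrite [Rcoef q n.+1 * _]mulrA bc -!scalerAr scalerN !scalerA
    [q^-1 * (Rcoef q n * _)]mulrA.
rewrite addrA; congr (_ + _).
rewrite {1}/Rsum mulr_sumr (big_shift (F := fun n => f * ((Rcoef q n * t ^+ n) *: X ^+ n))).
  rewrite !expr0 mulr1 -scalerAl -scalerAr mul1r mulr1; congr (_ + _).
  by apply: eq_bigr => n _; rewrite scalerAr.
by rewrite XN scaler0 mulr0.
Qed.
End Series.

(* The relations between q^{2 (H ⊗ H)} and the generators. *)
Definition qHH_like (A : pzRingType) (T : A) (l1 l2 : leg A) :=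
  [/\ T * l1 GK = l1 GK * T, T * l1 GE = l1 GE * (l2 GK * l2 GK) * T
    & T * l1 GF = l1 GF * (l2 GKi * l2 GKi) * T] /\
  [/\ T * l2 GK = l2 GK * T, T * l2 GE = l2 GE * (l1 GK * l1 GK) * T
    & T * l2 GF = l2 GF * (l1 GKi * l1 GKi) * T].

(** * Conjugation by R of the first tensor factors of Delta(C) *)

Section Intertwining.
Variables (K : fieldType) (q : K) (A : algType K) (l1 l2 : leg A).
Variables (T : A) (N : nat).

Local Notation c1 := (letter_of q l1 Gc).
Local Notation k1 := (letter_of q l1 Gk).
Local Notation ki1 := (letter_of q l1 Gki).
Local Notation x1 := (letter_of q l1 Gx).
Local Notation f1 := (letter_of q l1 Gf).
Local Notation k2 := (letter_of q l2 Gk).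
Local Notation ki2 := (letter_of q l2 Gki).
Local Notation f2 := (letter_of q l2 Gf).
Local Notation m := (q - q^-1).
Local Notation h := (q + q^-1).

Definition Rarg : A := (l1 GE * l1 GK) * (l2 GKi * l2 GF).
Local Notation X := Rarg.

Hypotheses (q0 : q != 0) (m0 : m != 0) (h0 : h != 0).
Hypothesis qn0 : forall n, qnum q n.+1 != 0.
Hypotheses (rel1 : is_leg q l1) (rel2 : is_leg q l2) (cm : leg_comm l1 l2).
Hypothesis TT : qHH_like T l1 l2.
Hypothesis XN : X ^+ N = 0.

Let sound a b p := @legs_rule_sound K q A q0 m0 h0 l1 l2 a b p rel1 rel2 cm.

Local Ltac lring := legs_ring q0 l1 l2 sound.

Local Notation Y := (x1 * k1 * (ki2 * f2)).
Local Notation Y' := (x1 * ki1 * (k2 * f2)).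
Local Notation g := (ki2 * f2).
Local Notation Th := (Rsum q X N 1).

(** [Y] is [X] written in letters, hence accessible to [lring]; the commutation relations of [X] are
    deduced from those of [Y]. *)
Let YE : Y = - m ^+ 2 *: X.
Proof. by rewrite /= -!scalerAl. Qed.

Let m20 : - m ^+ 2 != 0. Proof. by rewrite oppr_eq0 expf_neq0. Qed.

Let Xcomm (y : A) t : Y * y = t *: (y * Y) -> X * y = t *: (y * X).
Proof.
rewrite YE -scalerAl -scalerAr scalerA mulrC -scalerA.
exact: scaler_inj.
Qed.

Let Th_comm (y : A) : Y * y = y * Y -> Th * y = y * Th.
Proof. by move=> Yy; apply: Rsum_skew; apply: Xcomm; rewrite scale1r. Qed.

(** The functional equation in terms of [Y]. Its factor 1 + q^-1 Y is the source of the corrections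
    in [tauK] and [tauF], where conjugation by T has been applied to it. *)
Lemma Rsum_shiftY : Rsum q X N (q ^- 2) = (1 + q^-1 *: Y) * Th.
Proof.
rewrite Rsum_shift // mulrDl mul1r YE scalerA -!scalerAl; congr (_ + _).
by rewrite -scaleNr mulrN mulrC.
Qed.

Lemma Th_c1 : Th * c1 = c1 * Th. Proof. by apply: Th_comm; lring. Qed.

Lemma Th_KX : Th * (k1 * x1) = k1 * x1 * Th.
Proof. by apply: Th_comm; lring. Qed.

Lemma Th_KK : Th * (k1 * k1) = k1 * k1 * (1 + q^-1 *: Y) * Th.
Proof.
rewrite -mulrA -Rsum_shiftY; apply: Rsum_skew; apply: Xcomm.
have -> : Y * (k1 * k1) = q^-1 *: (q^-1 *: (k1 * k1 * Y)) by lring.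
by rewrite scalerA expr2 invfM.
Qed.

Lemma Th_FK : Th * (f1 * k1) =
  ((f1 * k1 + q^-1 *: (g * (k1 * k1 * (k1 * k1)))) * (1 + q^-1 *: Y)
    - q^-1 *: g) * Th.
Proof.
rewrite (@Rsum_commutator _ _ _ _ _ q0 m0 qn0 XN (f1 * k1) g
  (k1 * k1 * (k1 * k1))).
- rewrite Rsum_shiftY; move: (1 + _) => B.
  rewrite scalerBr addrA mulrBl mulrDl !mulrDl -!scalerAl.
  by rewrite !mulrA.
- apply: (scaler_inj m20).
  rewrite scalerAl -YE scalerDr !scalerA [- m ^+ 2 * q ^- 2]mulrC -[(q ^- 2 * _) *: _]scalerA.
  rewrite [- m ^+ 2 *: (_ * X)]scalerAr -YE.
  have -> : - m ^+ 2 * (q^-1 / m) = - (m * q^-1).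
    by rewrite mulNr mulrCA expr2 mulfK // mulrC.
  have -> : q ^- 2 *: (f1 * k1 * Y) = q^-1 *: (q^-1 *: (f1 * k1 * Y)).
    by rewrite scalerA -invfM -expr2.
  rewrite scaleNr -scalerA; lring.
- by rewrite -[RHS]scale1r; apply: Xcomm; rewrite scale1r; lring.
apply: Xcomm.
have -> : Y * (k1 * k1 * (k1 * k1)) =
  q^-1 *: (q^-1 *: (q^-1 *: (q^-1 *: (k1 * k1 * (k1 * k1) * Y)))) by lring.
by rewrite !scalerA -exprVn !exprS expr0 mulr1 !mulrA.
Qed.

Let TK1 : T * k1 = k1 * T. Proof. by case: TT => -[]. Qed.
Let TK2 : T * k2 = k2 * T. Proof. by case: TT => _ []. Qed.
Let TX1 : T * x1 = x1 * (k2 * k2) * T.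
Proof. by case: TT => -[_ e _] _; rewrite /= -!scalerAr e -!scalerAl. Qed.
Let TF1 : T * f1 = f1 * (ki2 * ki2) * T. Proof. by case: TT => -[]. Qed.
Let TF2 : T * f2 = f2 * (ki1 * ki1) * T. Proof. by case: TT => _ []. Qed.
Let Tinv (l : leg A) : is_leg q l -> T * l GK = l GK * T -> T * l GKi = l GKi * T.
Proof.
case=> kki kik _ _ _ Tk.
rewrite -[LHS]mul1r -kik -mulrA [l GK * (_ * _)]mulrA -Tk -!mulrA kki mulr1.
by [].
Qed.
Let TKi1 : T * ki1 = ki1 * T. Proof. exact: Tinv rel1 TK1. Qed.
Let TKi2 : T * ki2 = ki2 * T. Proof. exact: Tinv rel2 TK2. Qed.

Let conj_mul (a a' b b' : A) :
  T * a = a' * T -> T * b = b' * T -> T * (a * b) = a' * b' * T.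
Proof. by move=> Ta Tb; rewrite mulrA Ta -mulrA Tb mulrA. Qed.

Let conj_add (a a' b b' : A) :
  T * a = a' * T -> T * b = b' * T -> T * (a + b) = (a' + b') * T.
Proof. by move=> Ta Tb; rewrite mulrDr Ta Tb mulrDl. Qed.

Let conj_scale z (a a' : A) :
  T * a = a' * T -> T * (z *: a) = z *: a' * T.
Proof. by move=> Ta; rewrite -scalerAr Ta scalerAl. Qed.

Let conj_Th (a b y : A) :
  Th * y = a * Th -> T * a = b * T -> b * (T * Th) = T * Th * y.
Proof. by move=> Thy Ta; rewrite mulrA -Ta -!mulrA Thy. Qed.

(** C is central in its leg, so Theta causes no change; the powers q^{-2H} and q^{2H} of the second
    leg that arise when T passes F and E cancel. *)
Lemma R_c1 : c1 * (T * Th) = T * Th * c1.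
Proof.
have cE (l : leg A) : letter_of q l Gc = letter_of q l Gf * letter_of q l Gx
    + (- q) *: (letter_of q l Gk * letter_of q l Gk)
    + (- q^-1) *: (letter_of q l Gki * letter_of q l Gki).
  by rewrite letter_fx // !scaleNr [X in X - _ - _]addrAC !addrK.
apply: (conj_Th Th_c1).
have -> : T * c1 = (f1 * (ki2 * ki2) * (x1 * (k2 * k2))
    + (- q) *: (k1 * k1) + (- q^-1) *: (ki1 * ki1)) * T.
  rewrite cE; apply: conj_add; last exact: conj_scale (conj_mul TKi1 TKi1).
  by apply: conj_add; [apply: conj_mul | apply: conj_scale (conj_mul TK1 TK1)].
by congr (_ * T); rewrite !scaleNr; lring.
Qed.

Let TY : T * Y = Y' * T.
Proof.
rewrite (conj_mul (conj_mul TX1 TK1) (conj_mul TKi2 TF2)).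
by congr (_ * T); lring.
Qed.

Let T1Y : T * (1 + q^-1 *: Y) = (1 + q^-1 *: Y') * T.
Proof. by apply: conj_add; [rewrite mulr1 mul1r | apply: conj_scale]. Qed.

Lemma R_KX : tauE q l1 l2 * (T * Th) = T * Th * (k1 * x1).
Proof.
apply: (conj_Th Th_KX); rewrite (conj_mul TK1 TX1) /tauE.
by congr (_ * T); lring.
Qed.

Lemma R_KK : tauK q l1 l2 * (T * Th) = T * Th * (k1 * k1).
Proof.
apply: (conj_Th Th_KK); rewrite (conj_mul (conj_mul TK1 TK1) T1Y) /tauK.
by congr (_ * T); lring.
Qed.

Lemma R_FK : tauF q l1 l2 * (T * Th) = T * Th * (f1 * k1).
Proof.
apply: (conj_Th Th_FK).
have Tg : T * g = ki2 * (f2 * (ki1 * ki1)) * T by apply: conj_mul TKi2 TF2.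
have TKK := conj_mul TK1 TK1.
rewrite -scaleN1r.
rewrite (conj_add (conj_mul (conj_add (conj_mul TF1 TK1)
  (conj_scale _ (conj_mul Tg (conj_mul TKK TKK)))) T1Y)
  (conj_scale _ (conj_scale _ Tg))) scaleN1r /tauF.
by congr (_ * T); lring.
Qed.
End Intertwining.

(** * The Askey-Wilson relations *)

Section AskeyWilson.
Variables (K : fieldType) (q : K) (A : algType K).

Definition qbracket (x y : A) : A :=
  (q - q^-1)^-1 *: (q *: (x * y) - q^-1 *: (y * x)).

(* [aw13] and, below, [aw13op] are C_13^(0) and C_13^(1), defined through the
   q-commutator of C_12 and C_23. *)
Definition aw13 (l1 l2 l3 : leg A) : A :=
  qbracket (cas q (comul l1 l2)) (cas q (comul l2 l3))
  - cas q l1 * cas q l3 - cas q l2 * cas q (comul (comul l1 l2) l3).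

(** Passage from C to the letter c = (q + q^-1) C: the relation is multiplied by (q + q^-1)^2, which
    leaves an additional factor q + q^-1 in the linear term. *)
Lemma qbracket_hat (a b z u u' v v' : A) :
    q - q^-1 != 0 -> q + q^-1 != 0 ->
  let h := q + q^-1 in
  q *: ((h *: a) * (h *: b)) - q^-1 *: ((h *: b) * (h *: a)) =
    (q - q^-1) *: (h *: (h *: z) + (h *: u) * (h *: u') + (h *: v) * (h *: v')) ->
  qbracket a b = z + u * u' + v * v'.
Proof.
move=> m0 h0 /=; set h := q + q^-1.
have hh (x y : A) : (h *: x) * (h *: y) = (h * h) *: (x * y).
  by rewrite -scalerAl -scalerAr scalerA.
have swap c (x : A) : c *: ((h * h) *: x) = (h * h) *: (c *: x).
  by rewrite !scalerA [c * _]mulrC.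
rewrite !hh [h *: (h *: z)]scalerA -!scalerDr !swap -scalerBr.
move=> /(scaler_inj (mulf_neq0 h0 h0)); rewrite /qbracket => ->.
by rewrite scalerA mulVf // scale1r.
Qed.

End AskeyWilson.

Section ThreeLegs.
Variables (K : fieldType) (q : K) (A : algType K) (l1 l2 l3 : leg A).

Local Notation c1 := (letter_of q l1 Gc).
Local Notation k1 := (letter_of q l1 Gk).
Local Notation x1 := (letter_of q l1 Gx).
Local Notation f1 := (letter_of q l1 Gf).
Local Notation c2 := (letter_of q l2 Gc).
Local Notation k2 := (letter_of q l2 Gk).
Local Notation ki2 := (letter_of q l2 Gki).
Local Notation x2 := (letter_of q l2 Gx).
Local Notation f2 := (letter_of q l2 Gf).
Local Notation c3 := (letter_of q l3 Gc).
Local Notation ki3 := (letter_of q l3 Gki).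
Local Notation x3 := (letter_of q l3 Gx).
Local Notation f3 := (letter_of q l3 Gf).
Local Notation m := (q - q^-1).
Local Notation h := (q + q^-1).
Local Notation tauK := (tauK q l1 l2).
Local Notation tauF := (tauF q l1 l2).
Local Notation tauE := (tauE q l1 l2).
Local Notation D := (delta_c q l1 l2).

Hypotheses (q0 : q != 0) (m0 : m != 0) (h0 : h != 0).
Hypotheses (rel1 : is_leg q l1) (rel2 : is_leg q l2) (rel3 : is_leg q l3).
Hypotheses (cm12 : leg_comm l1 l2) (cm13 : leg_comm l1 l3)
  (cm23 : leg_comm l2 l3).

(** The coefficients are taken from the first two legs. An equation between such sums is proved by
    comparing coefficients. *)
Definition third_leg (a b c d : A) : A :=
  a * c3 + b * (ki3 * ki3) + c * (ki3 * x3) + d * (f3 * ki3).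

Lemma third_legD a b c d a' b' c' d' :
  third_leg a b c d + third_leg a' b' c' d' =
  third_leg (a + a') (b + b') (c + c') (d + d').
Proof.
by rewrite /third_leg !mulrDl (AC (4*4) ((1*5)*(2*6)*(3*7)*(4*8))).
Qed.

Lemma third_legZ z a b c d :
  z *: third_leg a b c d = third_leg (z *: a) (z *: b) (z *: c) (z *: d).
Proof. by rewrite /third_leg !scalerDr !scalerAl. Qed.

Lemma third_legN a b c d :
  - third_leg a b c d = third_leg (- a) (- b) (- c) (- d).
Proof. by rewrite -scaleN1r third_legZ !scaleN1r. Qed.

Lemma mul_third_leg y a b c d :
  y * third_leg a b c d = third_leg (y * a) (y * b) (y * c) (y * d).
Proof. by rewrite /third_leg !mulrDr !mulrA. Qed.

Lemma third_leg_mul y a b c d : (forall g, y * l3 g = l3 g * y) ->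
  third_leg a b c d * y = third_leg (a * y) (b * y) (c * y) (d * y).
Proof.
move=> /(letter_comm q) yl; rewrite /third_leg !mulrDl; congr (_ + _ + _ + _).
- by rewrite -!mulrA yl.
- by rewrite -!mulrA -yl [ki3 * (y * _)]mulrA -yl -mulrA.
- by rewrite -!mulrA -yl [ki3 * (y * _)]mulrA -yl -mulrA.
by rewrite -!mulrA -yl [f3 * (y * _)]mulrA -yl -mulrA.
Qed.

Lemma mulc3 y : y * c3 = third_leg y 0 0 0.
Proof. by rewrite /third_leg !mul0r !addr0. Qed.

(** With [l] equal to [l1], [l2] or [comul l1 l2] this expands C_13, C_23 or C_123 in the third
    leg. *)
Lemma delta_c13E (l : leg A) : delta_c q l l3 =
  third_leg (l GK * l GK) (letter_of q l Gc + h *: (l GK * l GK))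
    (l GF * l GK) (l GK * letter_of q l Gx).
Proof.
rewrite /delta_c /third_leg mulrDl scalerAl; congr (_ + _ + _).
by rewrite addrA; congr (_ + _); rewrite addrC.
Qed.

Lemma comul_comm : leg_comm (comul l1 l2) l3.
Proof.
have cM (a b c : A) : a * c = c * a -> b * c = c * b -> a * b * c = c * (a * b).
  by move=> ac bc; rewrite -mulrA bc mulrA ac mulrA.
by case=> g /=; [rewrite mulrDl mulrDr; congr (_ + _)
  |rewrite mulrDl mulrDr; congr (_ + _)| |]; apply: (cM).
Qed.

Lemma rel12 : is_leg q (comul l1 l2). Proof. exact: comul_is_leg. Qed.

Let Dl3 g : D * l3 g = l3 g * D.
Proof.
rewrite -(delta_cE q0 m0 h0) //; apply/esym; apply: letter_comm => g'.
by rewrite comul_comm.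
Qed.

Lemma aw13E : aw13 q l1 l2 l3 =
  h^-1 *: third_leg tauK (c1 + h *: tauK) tauF tauE.
Proof.
set Z := third_leg _ _ _ _.
(* Restores the two products subtracted in [aw13], so that the claim becomes a formula for the
   q-commutator. *)
have -> : h^-1 *: Z = h^-1 *: Z + cas q l1 * cas q l3
    + cas q l2 * cas q (comul (comul l1 l2) l3)
    - cas q l1 * cas q l3 - cas q l2 * cas q (comul (comul l1 l2) l3).
  by rewrite [_ + _ + _ - cas q l1 * _]addrAC !addrK.
congr (_ - _ - _); apply: (qbracket_hat m0 h0).
rewrite [h *: (_^-1 *: _)]scalerA mulfV // scale1r.
change (q *: (letter_of q (comul l1 l2) Gc * letter_of q (comul l2 l3) Gc)
  - q^-1 *: (letter_of q (comul l2 l3) Gc * letter_of q (comul l1 l2) Gc)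
  = m *: (h *: Z + c1 * c3 + c2 * letter_of q (comul (comul l1 l2) l3) Gc)).
rewrite !delta_cE //; [|exact: rel12|exact: comul_comm].
rewrite !delta_c13E mul_third_leg third_leg_mul // [c1 * c3]mulc3.
rewrite [c2 * third_leg _ _ _ _]mul_third_leg !(third_legZ, third_legN, third_legD).
rewrite letter_comulx delta_cE // !addr0; congr third_leg.
- exact: bracket_KK.
- exact: bracket_cKK.
- exact: bracket_FK.
exact: bracket_KX.
Qed.

Lemma aw13_qbracket :
  qbracket q (aw13 q l1 l2 l3) (cas q (comul l1 l2)) =
  cas q (comul l2 l3) + cas q l2 * cas q l3
    + cas q l1 * cas q (comul (comul l1 l2) l3).
Proof.
apply: (qbracket_hat m0 h0); rewrite aw13E.
set Z := third_leg _ _ _ _.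
rewrite [h *: (_^-1 *: _)]scalerA mulfV // scale1r.
change (q *: (Z * letter_of q (comul l1 l2) Gc)
  - q^-1 *: (letter_of q (comul l1 l2) Gc * Z)
  = m *: (h *: letter_of q (comul l2 l3) Gc + c2 * c3
          + c1 * letter_of q (comul (comul l1 l2) l3) Gc)).
rewrite !delta_cE //; [|exact: rel12|exact: comul_comm].
rewrite !delta_c13E /Z !mul_third_leg third_leg_mul // [c2 * c3]mulc3.
rewrite !(third_legZ, third_legN, third_legD).
rewrite letter_comulx delta_cE // !addr0; congr third_leg.
- exact: cobracket_tauK.
- exact: cobracket_ctauK.
- exact: cobracket_tauF.
exact: cobracket_tauE.
Qed.

Variables (T : A) (N : nat).
Hypothesis qn0 : forall n, qnum q n.+1 != 0.
Hypothesis TT : qHH_like T l1 l2.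
Hypothesis T3 : forall g, T * l3 g = l3 g * T.
Hypothesis XN : Rarg l1 l2 ^+ N = 0.

Lemma aw13_R (R := T * Rsum q (Rarg l1 l2) N 1) :
  aw13 q l1 l2 l3 * R = R * cas q (comul l1 l3).
Proof.
(* Hence conjugation by R acts on the coefficients of [third_leg] alone. *)
have R3 g : R * l3 g = l3 g * R.
  rewrite /R mulrA -T3 -!mulrA; congr (_ * _).
  rewrite mulr_suml mulr_sumr; apply: eq_bigr => n _.
  rewrite -scalerAl -scalerAr; congr (_ *: _).
  apply/esym/commrX; rewrite /GRing.comm /Rarg.
  by do 2?apply: commrM; rewrite /GRing.comm ?cm13 ?cm23.
apply: (scaler_inj h0); rewrite scalerAl scalerAr.
change (h *: aw13 q l1 l2 l3 * R = R * letter_of q (comul l1 l3) Gc).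
rewrite aw13E scalerA mulfV // scale1r delta_cE // delta_c13E.
rewrite third_leg_mul // mul_third_leg.
have RK : tauK * R = R * (k1 * k1) by exact: R_KK.
congr third_leg => //; first 1 last.
- exact: R_FK.
- exact: R_KX.
rewrite mulrDl mulrDr -(scalerAl h tauK R) -(scalerAr h R (k1 * k1)) RK.
by congr (_ + _); apply: R_c1.
Qed.
End ThreeLegs.

(** * Symmetries *)

(* The automorphism E <-> F, q^H <-> q^-H combined with reversal of the legs
   exchanges [aw13] with [aw13op], C_12 with C_23 and R_12 with R_23; the
   antiautomorphism E <-> F fixing q^H exchanges [aw13] with [aw13op] and R_12
   with R~_12. *)
Definition chev (A : Type) (l : leg A) : leg A :=
  mkleg (l GF) (l GE) (l GKi) (l GK).

(** Composing a leg with an antiautomorphism of U gives a leg of the opposite algebra. *)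
Definition transp (A : pzRingType) (l : leg A) : leg A^c :=
  mkleg (l GF) (l GE) (l GK) (l GKi).

Definition Rarg' (A : pzRingType) (l1 l2 : leg A) : A :=
  (l1 GF * l1 GK) * (l2 GKi * l2 GE).

Lemma cas_ext (K : fieldType) (q : K) (A : algType K) (l l' : leg A) :
  l =1 l' -> cas q l = cas q l'.
Proof. by move=> e; rewrite /cas !e. Qed.

Section Symmetries.
Variables (K : fieldType) (q : K) (A : algType K).
Implicit Types l : leg A.
Hypotheses (q0 : q != 0) (m0 : q - q^-1 != 0) (h0 : q + q^-1 != 0).

Lemma leg_kif l : is_leg q l -> l GKi * l GF = q *: (l GF * l GKi).
Proof.
case=> kki kik _ kf _; have <- : l GKi * (l GK * l GF) * l GKi = l GF * l GKi.
  by rewrite mulrA kik mul1r.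
by rewrite kf -scalerAr -scalerAl scalerA mulfV // scale1r -!mulrA kki mulr1.
Qed.

Lemma leg_kie l : is_leg q l -> l GKi * l GE = q^-1 *: (l GE * l GKi).
Proof.
case=> kki kik ke _ _; have <- : l GKi * (l GK * l GE) * l GKi = l GE * l GKi.
  by rewrite mulrA kik mul1r.
by rewrite ke -scalerAr -scalerAl scalerA mulVf // scale1r -!mulrA kki mulr1.
Qed.

Lemma chev_is_leg l : is_leg q l -> is_leg q (chev l).
Proof.
move=> rel; have [kki kik ke kf ef] := rel.
split=> //=; [exact: leg_kif|exact: leg_kie|].
by rewrite -opprB ef -scalerN opprB.
Qed.

Lemma transp_is_leg l : is_leg q l -> is_leg q (transp l).
Proof.
case=> kki kik ke kf ef; split=> //.
- change (l GF * l GK = q *: (l GK * l GF)).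
  by rewrite kf scalerA mulfV ?scale1r.
change (l GE * l GK = q^-1 *: (l GK * l GE)).
by rewrite ke scalerA mulVf ?scale1r.
Qed.

Lemma chev_comm l l' : leg_comm l l' -> leg_comm (chev l') (chev l).
Proof. by move=> cm [] [] /=; rewrite cm. Qed.

Lemma transp_comm l l' : leg_comm l l' -> leg_comm (transp l) (transp l').
Proof. by move=> cm [] []; apply: esym; apply: cm. Qed.

(** [chev] turns FE into EF and exchanges q^{2H} with q^{-2H}, so [letter_fx] for [chev l] and
    [letter_xf] for [l] contain the same squares. *)
Lemma cas_chev l : is_leg q l -> cas q (chev l) = cas q l.
Proof.
move=> rel.
apply: (scaler_inj h0).
change (letter_of q (chev l) Gc = letter_of q l Gc).
have e1 := letter_xf m0 h0 rel.
have e2 := letter_fx m0 h0 (chev l).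
have E : letter_of q (chev l) Gf * letter_of q (chev l) Gx =
  letter_of q l Gx * letter_of q l Gf.
  by rewrite /= -scalerAl -scalerAr.
move: e2; rewrite E e1 /= => /esym.
by rewrite addrAC => /addIr /addIr.
Qed.

(** The exchange of E with F and the reversal of products cancel on FE. *)
Lemma cas_transp l : cas q (transp l) = cas q l.
Proof. by []. Qed.

(** The automorphism turns Delta into the opposite coproduct; this forces the reversal of the
    legs. *)
Lemma comul_chev l l' : leg_comm l l' ->
  comul (chev l') (chev l) =1 chev (comul l l').
Proof.
move=> cm [] /=; [| |exact/esym/cm|exact/esym/cm].
  by rewrite [RHS]addrC; congr (_ + _); rewrite cm.
by rewrite [RHS]addrC; congr (_ + _); rewrite cm.
Qed.

Lemma comul_transp l l' : leg_comm l l' ->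
  comul (transp l) (transp l') =1 transp (comul l l').
Proof.
move=> cm []; [| |exact: esym (cm _ _)|exact: esym (cm _ _)].
  change (l' GKi * l GF + l' GF * l GK = l GF * l' GKi + l GK * l' GF).
  by rewrite !cm.
change (l' GKi * l GE + l' GE * l GK = l GE * l' GKi + l GK * l' GE).
by rewrite !cm.
Qed.

Lemma comul_ext l1 l2 l1' l2' :
  l1 =1 l1' -> l2 =1 l2' -> comul l1 l2 =1 comul l1' l2'.
Proof. by move=> e e' [] /=; rewrite !e !e'. Qed.

Lemma comulA l1 l2 l3 : comul l1 (comul l2 l3) =1 comul (comul l1 l2) l3.
Proof.
by case=> /=; [rewrite mulrDl mulrDr !mulrA addrA|
  rewrite mulrDl mulrDr !mulrA addrA|rewrite mulrA|rewrite mulrA].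
Qed.

End Symmetries.

Definition leg_triple (K : fieldType) (q : K) (A : algType K) (l1 l2 l3 : leg A) :=
  [/\ is_leg q l1, is_leg q l2 & is_leg q l3] /\
  [/\ leg_comm l1 l2, leg_comm l1 l3 & leg_comm l2 l3].

Definition aw13op (K : fieldType) (q : K) (A : algType K) (l1 l2 l3 : leg A) : A :=
  qbracket q (cas q (comul l2 l3)) (cas q (comul l1 l2))
  - cas q l1 * cas q l3 - cas q l2 * cas q (comul (comul l1 l2) l3).

(** * Relations and R-matrix identities deduced by symmetry *)

Section Triples.
Variables (K : fieldType) (q : K).
Hypotheses (q0 : q != 0) (m0 : q - q^-1 != 0) (h0 : q + q^-1 != 0).
Hypothesis qn0 : forall n, qnum q n.+1 != 0.

Lemma chev_triple (A : algType K) (l1 l2 l3 : leg A) :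
  leg_triple q l1 l2 l3 -> leg_triple q (chev l3) (chev l2) (chev l1).
Proof.
case=> -[r1 r2 r3] [cm12 cm13 cm23].
by split; split; by [apply: chev_is_leg|apply: chev_comm].
Qed.

Lemma transp_triple (A : algType K) (l1 l2 l3 : leg A) :
  leg_triple q l1 l2 l3 -> leg_triple q (transp l1) (transp l2) (transp l3).
Proof.
case=> -[r1 r2 r3] [cm12 cm13 cm23].
by split; split; by [apply: transp_is_leg|apply: transp_comm].
Qed.

Lemma cas_comm (A : algType K) (y : A) (l : leg A) :
  (forall g, y * l g = l g * y) -> y * cas q l = cas q l * y.
Proof.
move=> yl; apply: (scaler_inj h0); rewrite scalerAr scalerAl.
exact: (letter_comm q yl Gc).
Qed.

Lemma comm_comul (A : algType K) (y : A) (l l' : leg A) :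
  (forall g, y * l g = l g * y) -> (forall g, y * l' g = l' g * y) ->
  forall g, y * comul l l' g = comul l l' g * y.
Proof.
move=> yl yl' [] /=; [apply: commrD; apply: commrM|apply: commrD; apply: commrM
  |apply: commrM|apply: commrM]; by [apply: yl|apply: yl'].
Qed.

Lemma cas_central (A : algType K) (l : leg A) g :
  is_leg q l -> cas q l * l g = l g * cas q l.
Proof.
move=> rel; apply: (scaler_inj h0); rewrite scalerAl scalerAr.
have central g' : letter_of q l g' * letter_of q l Gc
    = letter_of q l Gc * letter_of q l g'.
  have rs := letter_rule_sound q0 m0 h0 rel.
  case: g' => //; [rewrite (rs Gk Gc _ erefl)|rewrite (rs Gki Gc _ erefl)
    |rewrite (rs Gx Gc _ erefl)|rewrite (rs Gf Gc _ erefl)];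
    by rewrite big_seq1 expr0z mulr1 scale1r !big_cons big_nil mulr1.
apply: esym; case: g.
- apply: (@scaler_inj _ _ (- (q - q^-1) ^+ 2)).
    by rewrite oppr_eq0 expf_neq0.
  by rewrite scalerAl scalerAr; apply: (central Gx).
- exact: (central Gf).
- exact: (central Gk).
exact: (central Gki).
Qed.

Section Triple.
Variables (A : algType K) (l1 l2 l3 : leg A).
Hypothesis L : leg_triple q l1 l2 l3.
Local Notation C1 := (cas q l1).
Local Notation C2 := (cas q l2).
Local Notation C3 := (cas q l3).
Local Notation C12 := (cas q (comul l1 l2)).
Local Notation C13 := (cas q (comul l1 l3)).
Local Notation C23 := (cas q (comul l2 l3)).
Local Notation C123 := (cas q (comul (comul l1 l2) l3)).

Lemma cas123_comm (y : A) : (forall g, y * l1 g = l1 g * y) ->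
  (forall g, y * l2 g = l2 g * y) -> (forall g, y * l3 g = l3 g * y) ->
  y * C123 = C123 * y.
Proof.
by move=> *; apply: cas_comm => g; apply: comm_comul => // g'; apply: comm_comul.
Qed.

Lemma cas_comm13 : C3 * C1 = C1 * C3.
Proof.
have [_ [_ cm13 _]] := L.
apply: cas_comm => g; apply/esym; apply: cas_comm => g'; exact: cm13.
Qed.

Lemma cas_comm_legs (l l' : leg A) g :
  leg_comm l l' -> cas q l * l' g = l' g * cas q l.
Proof. by move=> cm; apply/esym; apply: cas_comm => g'; rewrite cm. Qed.

Lemma cas_comm_legs' (l l' : leg A) g :
  leg_comm l' l -> cas q l * l' g = l' g * cas q l.
Proof. by move=> cm; apply/esym; apply: cas_comm => g'; rewrite cm. Qed.

Lemma cas1_comm123 : C1 * C123 = C123 * C1.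
Proof.
have [[r1 r2 r3] [cm12 cm13 cm23]] := L; apply: cas123_comm => g.
- exact: cas_central.
- exact: cas_comm_legs.
exact: cas_comm_legs.
Qed.

Lemma cas2_comm123 : C2 * C123 = C123 * C2.
Proof.
have [[r1 r2 r3] [cm12 cm13 cm23]] := L; apply: cas123_comm => g.
- exact: cas_comm_legs'.
- exact: cas_central.
exact: cas_comm_legs.
Qed.

Lemma cas_comul_chev (l l' : leg A) : is_leg q l -> is_leg q l' -> leg_comm l l' ->
  cas q (comul (chev l') (chev l)) = cas q (comul l l').
Proof.
move=> r r' cm; rewrite (cas_ext _ (comul_chev cm)) cas_chev //.
exact: comul_is_leg.
Qed.

Lemma cas_comul2_chev :
  cas q (comul (comul (chev l3) (chev l2)) (chev l1)) = C123.
Proof.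
have [[r1 r2 r3] [cm12 cm13 cm23]] := L.
have cm1 : leg_comm l1 (comul l2 l3).
  move=> g h; apply: comm_comul => g'; [exact: cm12|exact: cm13].
rewrite (cas_ext _ (comul_ext (comul_chev cm23) (frefl _))).
rewrite cas_comul_chev //; last exact: comul_is_leg.
exact/cas_ext/comulA.
Qed.

Lemma aw13_chev : aw13 q (chev l3) (chev l2) (chev l1) = aw13op q l1 l2 l3.
Proof.
have [[r1 r2 r3] [cm12 cm13 cm23]] := L.
by rewrite /aw13 cas_comul2_chev !cas_comul_chev // !cas_chev // cas_comm13.
Qed.

Lemma cas_comul_transp (l l' : leg A) : leg_comm l l' ->
  cas q (comul (transp l) (transp l')) = cas q (comul l l') :> A.
Proof.
by move=> cm; rewrite (cas_ext _ (comul_transp cm)); apply: cas_transp.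
Qed.

Lemma cas_comul2_transp :
  cas q (comul (comul (transp l1) (transp l2)) (transp l3)) = C123 :> A.
Proof.
have [[r1 r2 r3] [cm12 cm13 cm23]] := L.
rewrite (cas_ext _ (comul_ext (comul_transp cm12) (frefl _))).
by apply: cas_comul_transp; apply: comul_comm.
Qed.

Lemma aw13_transp :
  aw13 q (transp l1) (transp l2) (transp l3) = aw13op q l1 l2 l3 :> A.
Proof.
have [[r1 r2 r3] [cm12 cm13 cm23]] := L.
rewrite /aw13 cas_comul2_transp !cas_comul_transp // !cas_transp.
(* Products of [A^c] are unfolded to products of [A], which reverses the q-commutator. *)
change (qbracket q C23 C12 - C3 * C1 - C123 * C2 = aw13op q l1 l2 l3).
by rewrite cas_comm13 -cas2_comm123.
Qed.

Lemma aw13_qbracket12 : qbracket q (aw13 q l1 l2 l3) C12 =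
  C23 + C2 * C3 + C1 * C123.
Proof. by have [[r1 r2 r3] [cm12 cm13 cm23]] := L; apply: aw13_qbracket. Qed.
End Triple.

Section MoreSymmetries.
Variables (A : algType K) (l1 l2 l3 : leg A).
Hypothesis L : leg_triple q l1 l2 l3.
Local Notation C1 := (cas q l1).
Local Notation C2 := (cas q l2).
Local Notation C3 := (cas q l3).
Local Notation C12 := (cas q (comul l1 l2)).
Local Notation C13 := (cas q (comul l1 l3)).
Local Notation C23 := (cas q (comul l2 l3)).
Local Notation C123 := (cas q (comul (comul l1 l2) l3)).

Lemma aw13op_chev : aw13op q (chev l3) (chev l2) (chev l1) = aw13 q l1 l2 l3.
Proof.
have [[r1 r2 r3] [cm12 cm13 cm23]] := L.
by rewrite /aw13op (cas_comul2_chev L) !cas_comul_chev // !cas_chev // (cas_comm13 L).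
Qed.

Lemma cas2_comm (l l' : leg A) : leg_comm l l' ->
  cas q l * cas q l' = cas q l' * cas q l.
Proof. by move=> cm; apply: cas_comm => g; apply: cas_comm_legs. Qed.

Lemma aw13op_qbracket23 : qbracket q (aw13op q l1 l2 l3) C23 =
  C12 + C1 * C2 + C3 * C123.
Proof.
have [[r1 r2 r3] [cm12 cm13 cm23]] := L.
have := aw13_qbracket12 (chev_triple L).
by rewrite aw13_chev // cas_comul2_chev // !cas_comul_chev // !cas_chev //
  [C2 * C1]cas2_comm // => g h; rewrite cm12.
Qed.

Lemma qbracket12_aw13op : qbracket q C12 (aw13op q l1 l2 l3) =
  C23 + C2 * C3 + C1 * C123.
Proof.
have [[r1 r2 r3] [cm12 cm13 cm23]] := L.
have := aw13_qbracket12 (transp_triple L).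
rewrite aw13_transp // cas_comul2_transp // !cas_comul_transp // !cas_transp.
change (qbracket q C12 (aw13op q l1 l2 l3) = C23 + C3 * C2 + C123 * C1 ->
  qbracket q C12 (aw13op q l1 l2 l3) = C23 + C2 * C3 + C1 * C123).
by rewrite (cas1_comm123 L) [C2 * C3]cas2_comm.
Qed.
End MoreSymmetries.

Lemma qbracket23_aw13 (A : algType K) (l1 l2 l3 : leg A) :
  leg_triple q l1 l2 l3 ->
  qbracket q (cas q (comul l2 l3)) (aw13 q l1 l2 l3) =
  cas q (comul l1 l2) + cas q l1 * cas q l2
    + cas q l3 * cas q (comul (comul l1 l2) l3).
Proof.
move=> L; have [[r1 r2 r3] [cm12 cm13 cm23]] := L.
have := qbracket12_aw13op (chev_triple L).
by rewrite aw13op_chev // cas_comul2_chev // !cas_comul_chev // !cas_chev //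
  [cas q l2 * _]cas2_comm // => g h; rewrite cm12.
Qed.

(** This relation is the definition of [aw13op]. *)
Lemma qbracket23_12 (A : algType K) (l1 l2 l3 : leg A) :
  qbracket q (cas q (comul l2 l3)) (cas q (comul l1 l2)) =
  aw13op q l1 l2 l3 + cas q l1 * cas q l3
    + cas q l2 * cas q (comul (comul l1 l2) l3).
Proof. by rewrite /aw13op addrAC !subrK. Qed.

Section RMatrix.
Variables (A : algType K) (l1 l2 l3 : leg A) (T : A) (N : nat).
Hypothesis L : leg_triple q l1 l2 l3.

Lemma aw13_R12 : qHH_like T l1 l2 -> (forall g, T * l3 g = l3 g * T) ->
    Rarg l1 l2 ^+ N = 0 ->
  let R := T * Rsum q (Rarg l1 l2) N 1 in
  aw13 q l1 l2 l3 * R = R * cas q (comul l1 l3).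
Proof.
by have [[r1 r2 r3] [cm12 cm13 cm23]] := L; move=> *; apply: aw13_R.
Qed.
End RMatrix.

Section RMatrixSym.
Variables (A : algType K) (l1 l2 l3 : leg A) (T : A) (N : nat).
Hypothesis L : leg_triple q l1 l2 l3.

Let T_inv (l : leg A) : is_leg q l -> T * l GK = l GK * T ->
  T * l GKi = l GKi * T.
Proof.
case=> kki kik _ _ _ Tk.
by rewrite -[LHS]mul1r -kik -mulrA [l GK * (_ * _)]mulrA -Tk -!mulrA kki mulr1.
Qed.

(** q^{2 (H ⊗ H)} is unchanged when both H change sign and when the factors are exchanged. *)
Lemma qHH_like_chev : qHH_like T l2 l3 -> qHH_like T (chev l3) (chev l2).
Proof.
have [[r1 r2 r3] _] := L.
by case=> -[k2 e2 f2] [k3 e3 f3]; split; split => //=; apply: T_inv.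
Qed.

(** Restoring the order of the factors costs q in one leg and q^-1 in the other. *)
Lemma Rarg_chev : Rarg (chev l3) (chev l2) = Rarg l2 l3.
Proof.
have [[r1 r2 r3] [cm12 cm13 cm23]] := L.
rewrite /Rarg /=; have [_ _ ke _ _] := r2.
have -> : l3 GF * l3 GKi = q^-1 *: (l3 GKi * l3 GF).
  by rewrite (leg_kif q0 r3) scalerA mulVf ?scale1r.
rewrite ke -scalerAl -scalerAr scalerA mulVf // scale1r.
have cm y : (forall g, y * l3 g = l3 g * y) ->
    y * (l3 GKi * l3 GF) = l3 GKi * l3 GF * y.
  by move=> yl; rewrite mulrA yl -mulrA yl mulrA.
by apply/esym/cm => g; rewrite -mulrA cm23 [LHS]mulrA cm23 -mulrA.
Qed.

Lemma qHH_like_transp : qHH_like T l1 l2 ->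
  @qHH_like A^c T (transp l1) (transp l2).
Proof.
have [[r1 r2 r3] [cm12 cm13 cm23]] := L.
case=> -[k1 e1 f1] [k2 e2 f2].
(* With w inverse to z and commuting with T and y, the relation T y = y z^2 T becomes y T = T w^2 y,
   which is the form required in [A^c]. *)
have move_T y z w : T * y = y * (z * z) * T -> T * w = w * T -> w * y = y * w ->
    w * z = 1 -> y * T = T * (w * w * y).
  move=> Ty Tw wy wz; rewrite !mulrA Tw -[w * T * w]mulrA Tw -!mulrA Ty !mulrA.
  rewrite -[w * w * y]mulrA wy mulrA wy -[y * w * w * z]mulrA wz mulr1.
  by rewrite -[y * w * z]mulrA wz mulr1.
have [kki1 kik1 _ _ _] := r1; have [kki2 kik2 _ _ _] := r2.
have ki1 := T_inv r1 k1; have ki2 := T_inv r2 k2.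
split; split.
- exact: esym k1.
- by apply: (move_T _ (l2 GKi)); rewrite ?cm12.
- by apply: (move_T _ (l2 GK)); rewrite ?cm12.
- exact: esym k2.
- by apply: (move_T _ (l1 GKi)); rewrite ?cm12.
by apply: (move_T _ (l1 GK)); rewrite ?cm12.
Qed.

Lemma Rarg_transp : Rarg (transp l1) (transp l2) = Rarg' l1 l2 :> A.
Proof.
have [[r1 r2 r3] [cm12 cm13 cm23]] := L.
change (l2 GE * l2 GKi * (l1 GK * l1 GF) = Rarg' l1 l2).
have [_ _ _ kf _] := r1.
have -> : l2 GE * l2 GKi = q *: (l2 GKi * l2 GE).
  by rewrite (leg_kie q0 r2) scalerA mulfV ?scale1r.
rewrite kf -scalerAl -scalerAr scalerA mulfV // scale1r /Rarg'.
have cm y : (forall g, y * l2 g = l2 g * y) ->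
    y * (l2 GKi * l2 GE) = l2 GKi * l2 GE * y.
  by move=> yl; rewrite mulrA yl -mulrA yl mulrA.
by apply/esym/cm => g; rewrite -mulrA cm12 [LHS]mulrA cm12 -mulrA.
Qed.

Lemma Rsum_transp (X : A) : Rsum q (X : A^c) N 1 = Rsum q X N 1 :> A.
Proof.
by apply: eq_bigr => n _; congr (_ *: _); apply: revrX.
Qed.

Lemma aw13op_R23 : qHH_like T l2 l3 -> (forall g, T * l1 g = l1 g * T) ->
    Rarg l2 l3 ^+ N = 0 ->
  let R := T * Rsum q (Rarg l2 l3) N 1 in
  aw13op q l1 l2 l3 * R = R * cas q (comul l1 l3).
Proof.
have [[r1 r2 r3] [cm12 cm13 cm23]] := L.
move=> TT T1 XN.
have := @aw13_R12 _ _ _ _ T N (chev_triple L) (qHH_like_chev TT).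
rewrite Rarg_chev aw13_chev // cas_comul_chev //; apply=> //.
by case; apply: T1.
Qed.

(** Read in the opposite algebra, T Theta becomes Theta T, the shape of R_21, and the sides of the
    intertwining relation are interchanged. *)
Lemma aw13op_R12 : qHH_like T l1 l2 -> (forall g, T * l3 g = l3 g * T) ->
    Rarg' l1 l2 ^+ N = 0 ->
  let R := Rsum q (Rarg' l1 l2) N 1 * T in
  R * aw13op q l1 l2 l3 = cas q (comul l1 l3) * R.
Proof.
have [[r1 r2 r3] [cm12 cm13 cm23]] := L.
move=> TT T3 XN.
have := @aw13_R12 _ _ _ _ (T : A^c) N (transp_triple L) (qHH_like_transp TT).
rewrite Rarg_transp aw13_transp // cas_comul_transp // => H.
rewrite -Rsum_transp; apply: H.
  by case; apply: esym; apply: T3.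
by rewrite -XN; apply: revrX.
Qed.
End RMatrixSym.

Lemma aw13_R23 (A : algType K) (l1 l2 l3 : leg A) (T : A) N :
    leg_triple q l1 l2 l3 ->
    qHH_like T l2 l3 -> (forall g, T * l1 g = l1 g * T) ->
    Rarg' l2 l3 ^+ N = 0 ->
  let R := Rsum q (Rarg' l2 l3) N 1 * T in
  R * aw13 q l1 l2 l3 = cas q (comul l1 l3) * R.
Proof.
move=> L; have [[r1 r2 r3] [cm12 cm13 cm23]] := L.
have <- : Rarg' (chev l3) (chev l2) = Rarg' l2 l3.
  rewrite /Rarg' /=; have [_ _ _ kf _] := r2.
  have -> : l3 GE * l3 GKi = q *: (l3 GKi * l3 GE).
    by rewrite (leg_kie q0 r3) scalerA mulfV ?scale1r.
  rewrite kf -scalerAl -scalerAr scalerA mulfV // scale1r.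
  have cm y : (forall g, y * l3 g = l3 g * y) ->
      y * (l3 GKi * l3 GE) = l3 GKi * l3 GE * y.
    by move=> yl; rewrite mulrA yl -mulrA yl mulrA.
  by apply/esym/cm => g; rewrite -mulrA cm23 [LHS]mulrA cm23 -mulrA.
move=> TT T1 XN.
have TT' := qHH_like_chev L TT.
have := aw13op_R12 (chev_triple L) TT' _ XN.
rewrite aw13op_chev // cas_comul_chev //; apply.
by case; apply: T1.
Qed.
End Triples.

(** * From the abstract legs to tensor powers and their completions *)

Definition alg_mor (K : fieldType) (A B : algType K) (f : A -> B) :=
  [/\ forall k x y, f (k *: x + y) = k *: f x + f y,
      forall x y, f (x * y) = f x * f y & f 1 = 1].

Section AlgMor.
Variables (K : fieldType) (q : K).

Section Theory.
Variables (A B : algType K) (f : A -> B).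
Hypothesis mor : alg_mor f.

Lemma morD x y : f (x + y) = f x + f y.
Proof. by have [fl _ _] := mor; rewrite -[x]scale1r fl !scale1r. Qed.

Lemma mor0 : f 0 = 0.
Proof. by have := morD 0 0; rewrite addr0 -[LHS]addr0 => /addrI. Qed.

Lemma morZ k x : f (k *: x) = k *: f x.
Proof. by have [fl _ _] := mor; rewrite -[k *: x]addr0 fl mor0 addr0. Qed.

Lemma morB x y : f (x - y) = f x - f y.
Proof. by rewrite -!scaleN1r morD morZ. Qed.

Lemma morM x y : f (x * y) = f x * f y. Proof. by have [] := mor. Qed.

Lemma mor1 : f 1 = 1. Proof. by have [] := mor. Qed.

Lemma morX x n : f (x ^+ n) = f x ^+ n.
Proof. by elim: n => [|n IH]; rewrite ?expr0 ?mor1 // !exprS morM IH. Qed.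

Lemma mor_cas (l : leg A) : f (cas q l) = cas q (f \o l).
Proof. by rewrite /cas !(morZ, morD, morM, morX). Qed.

Lemma mor_comul (l l' : leg A) : f \o comul l l' =1 comul (f \o l) (f \o l').
Proof. by case=> /=; rewrite ?morD ?morM. Qed.

Lemma mor_cas_comul (l l' : leg A) :
  f (cas q (comul l l')) = cas q (comul (f \o l) (f \o l')).
Proof. by rewrite mor_cas; apply/cas_ext/mor_comul. Qed.

Lemma mor_aw13 (l1 l2 l3 : leg A) :
  f (aw13 q l1 l2 l3) = aw13 q (f \o l1) (f \o l2) (f \o l3).
Proof.
rewrite /aw13 /qbracket !(morB, morZ, morM, mor_cas_comul, mor_cas).
by congr (_ - _ * _); apply/cas_ext/comul_ext => // g; apply: mor_comul.
Qed.

Lemma mor_aw13op (l1 l2 l3 : leg A) :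
  f (aw13op q l1 l2 l3) = aw13op q (f \o l1) (f \o l2) (f \o l3).
Proof.
rewrite /aw13op /qbracket !(morB, morZ, morM, mor_cas_comul, mor_cas).
by congr (_ - _ * _); apply/cas_ext/comul_ext => // g; apply: mor_comul.
Qed.

Lemma mor_is_leg (l : leg A) : is_leg q l -> is_leg q (f \o l).
Proof.
case=> kki kik ke kf ef; split=> /=.
- by rewrite -morM kki mor1.
- by rewrite -morM kik mor1.
- by rewrite -morM ke morZ morM.
- by rewrite -morM kf morZ morM.
by rewrite -!morM -morB ef morZ morB !morX.
Qed.

Lemma mor_leg_comm (l l' : leg A) : leg_comm l l' -> leg_comm (f \o l) (f \o l').
Proof. by move=> cm g h /=; rewrite -!morM cm. Qed.

Lemma mor_qHH_like T (l l' : leg A) :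
  qHH_like T l l' -> qHH_like (f T) (f \o l) (f \o l').
Proof.
by case=> -[k e g] [k' e' g']; split; split; rewrite /= -!morM ?k ?e ?g ?k' ?e' ?g'.
Qed.

Lemma mor_Rsum X N t : f (Rsum q X N t) = Rsum q (f X) N t.
Proof.
rewrite /Rsum; elim/big_rec2: _ => [|i y y' _ <-]; first exact: mor0.
by rewrite morD morZ morX.
Qed.
End Theory.

Lemma comp_mor (A B C : algType K) (g : B -> C) (f : A -> B) :
  alg_mor g -> alg_mor f -> alg_mor (g \o f).
Proof.
case=> gl gM g1 [fl fM f1].
by split=> [k x y|x y|] /=; rewrite ?fl ?gl ?fM ?gM ?f1 ?g1.
Qed.

Lemma id_mor (A : algType K) : alg_mor (@id A). Proof. by []. Qed.

Section Tensor.
Variables (A B M : algType K) (f : A -> B -> M).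
Hypothesis fDl : forall a a' b, f (a + a') b = f a b + f a' b.
Hypothesis fDr : forall a b b', f a (b + b') = f a b + f a b'.
Hypothesis fZl : forall k a b, f (k *: a) b = k *: f a b.
Hypothesis fZr : forall k a b, f a (k *: b) = k *: f a b.
Hypothesis fM : forall a a' b b', f (a * a') (b * b') = f a b * f a' b'.
Hypothesis f1 : f 1 1 = 1.

Lemma tens_lift_mor : alg_mor (tens_lift f).
Proof.
split=> [k x y|x y|]; first exact: tens_lift_linear.
  elim/tensW: x => s; elim/tensW: y => t.
  rewrite [_ * _]tens_mul_pi !tens_lift_pi //= /tens_mul_seq big_allpairs_dep /=.
  rewrite mulr_suml; apply: eq_bigr => p _; rewrite mulr_sumr.
  by apply: eq_bigr => r _; rewrite fM.
by rewrite -tpure1 tens_lift_pure.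
Qed.
End Tensor.

Section TensMap.
Variables (A B A' B' : algType K) (f : A -> A') (g : B -> B').
Hypotheses (fm : alg_mor f) (gm : alg_mor g).

Lemma tens_map_mor : alg_mor (tens_map f g).
Proof.
apply: tens_lift_mor => *.
- by rewrite (morD fm) tpureDl.
- by rewrite (morD gm) tpureDr.
- by rewrite (morZ fm) tpureZl.
- by rewrite (morZ gm) tpureZr.
- by rewrite (morM fm) (morM gm) tpureM.
by rewrite (mor1 fm) (mor1 gm) tpure1.
Qed.

Lemma tens_map_pureE a b : tens_map f g (a ⊗ b) = f a ⊗ g b.
Proof.
apply: tens_lift_pure => *.
- by rewrite (morD fm) tpureDl.
- by rewrite (morD gm) tpureDr.
- by rewrite (morZ fm) tpureZl.
by rewrite (morZ gm) tpureZr.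
Qed.
End TensMap.

Lemma tpurel_mor (A B : algType K) : alg_mor (fun x : A => x ⊗ (1 : B)).
Proof.
split=> [k x y|x y|]; last exact: tpure1.
  by rewrite tpureDl tpureZl.
by rewrite tpureM mulr1.
Qed.

Lemma tpurer_mor (A B : algType K) : alg_mor (fun x : B => (1 : A) ⊗ x).
Proof.
split=> [k x y|x y|]; last exact: tpure1.
  by rewrite tpureDr tpureZr.
by rewrite tpureM mulr1.
Qed.

Lemma Uq_lift_mor (A : algType K) (e f k ki : A) :
  Uq_relations q e f k ki -> alg_mor (@Uq_lift K q A e f k ki).
Proof.
move=> rel; split=> [c x y|x y|].
- by rewrite Uq_liftD // Uq_liftZ.
- exact: Uq_liftM.
exact: Uq_lift1.
Qed.

Definition Uleg : leg (Uq q) := mkleg (UE q) (UF q) (UK q) (UKi q).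

Lemma Uleg_is_leg : is_leg q Uleg. Proof. exact: UKE_relations. Qed.

Definition Uleg1 : leg (Uq3 q) := fun g => Uleg g ⊗ 1 ⊗ 1.
Definition Uleg2 : leg (Uq3 q) := fun g => 1 ⊗ Uleg g ⊗ 1.
Definition Uleg3 : leg (Uq3 q) := fun g => 1 ⊗ 1 ⊗ Uleg g.

Lemma Uleg_triple : leg_triple q Uleg1 Uleg2 Uleg3.
Proof.
split; split.
- apply: (@mor_is_leg _ _ _ (comp_mor (tpurel_mor _ _) (tpurel_mor _ _))).
  exact: Uleg_is_leg.
- apply: (@mor_is_leg _ _ _ (comp_mor (tpurel_mor _ _) (tpurer_mor _ _))).
  exact: Uleg_is_leg.
- exact: (@mor_is_leg _ _ _ (tpurer_mor _ _) _ Uleg_is_leg).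
- by move=> g h; rewrite !tpureM !mulr1 !mul1r.
- by move=> g h; rewrite !tpureM !mulr1 !mul1r.
by move=> g h; rewrite !tpureM !mulr1 !mul1r.
Qed.

Lemma C1E : C1 q = cas q Uleg1.
Proof. exact: (mor_cas (comp_mor (tpurel_mor _ _) (tpurel_mor _ _)) Uleg). Qed.
Lemma C2E : C2 q = cas q Uleg2.
Proof. exact: (mor_cas (comp_mor (tpurel_mor _ _) (tpurer_mor _ _)) Uleg). Qed.
Lemma C3E : C3 q = cas q Uleg3.
Proof. exact: (mor_cas (tpurer_mor _ _) Uleg). Qed.

Hypothesis q0 : q != 0.

Lemma Delta_mor : alg_mor (@Delta K q).
Proof. exact/Uq_lift_mor/Delta_relations. Qed.

Lemma Delta_gen g :
  Delta (Uleg g) = comul (fun g => Uleg g ⊗ 1) (fun g => 1 ⊗ Uleg g) g.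
Proof.
have rel := Delta_relations q0.
by case: g; rewrite /= ?tpureM ?mulr1 ?mul1r; rewrite /Delta;
  [rewrite Uq_liftE|rewrite Uq_liftF|rewrite Uq_liftK|rewrite Uq_liftKi].
Qed.

Lemma Delta_casimir : Delta (casimir q) =
  cas q (comul (fun g => Uleg g ⊗ 1) (fun g => 1 ⊗ Uleg g)).
Proof. by rewrite (mor_cas Delta_mor Uleg); apply/cas_ext/Delta_gen. Qed.

Lemma C12E : C12 q = cas q (comul Uleg1 Uleg2).
Proof. by rewrite /C12 Delta_casimir (mor_cas_comul (tpurel_mor _ _)). Qed.

(** Taking [f] to be x ↦ x ⊗ 1, x ↦ 1 ⊗ x or Delta yields C_13, C_23 or C_123. *)
Lemma tens_map_Delta_casimir (B : algType K) (f : Uq q -> B) : alg_mor f ->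
  tens_map f id (Delta (casimir q)) =
  cas q (comul (fun g => f (Uleg g) ⊗ 1) (fun g => 1 ⊗ Uleg g)).
Proof.
move=> fm; have idm := @id_mor (Uq q).
rewrite Delta_casimir (mor_cas_comul (tens_map_mor fm idm)); apply/cas_ext/comul_ext.
  by move=> g; rewrite /= tens_map_pureE.
by move=> g; rewrite /= tens_map_pureE // (mor1 fm).
Qed.

Lemma C23E : C23 q = cas q (comul Uleg2 Uleg3).
Proof. by rewrite /C23 (tens_map_Delta_casimir (tpurer_mor _ _)). Qed.

Lemma C13E : C13 q = cas q (comul Uleg1 Uleg3).
Proof. by rewrite /C13 (tens_map_Delta_casimir (tpurel_mor _ _)). Qed.

Lemma C123E : C123 q = cas q (comul (comul Uleg1 Uleg2) Uleg3).
Proof.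
rewrite /C123 (tens_map_Delta_casimir Delta_mor); apply/cas_ext/comul_ext => // g.
rewrite Delta_gen.
exact: (mor_comul (tpurel_mor _ _)).
Qed.
End AlgMor.

(** * Kronecker products of matrices *)

Section Kronecker.
Variable K : fieldType.

Lemma tens1mx1 m n : (1%:M : 'M[K]_m) *t (1%:M : 'M[K]_n) = 1%:M.
Proof.
apply/matrixP => i j.
case: (mxtens_indexP i) => i1 i2; case: (mxtens_indexP j) => j1 j2.
rewrite tensmxE !mxE (can_eq (@mxtens_indexK _ _)) xpair_eqE.
by case: eqP => _; case: eqP => _ /=; rewrite ?mulr1 ?mul0r ?mulr0.
Qed.

Lemma tensmxDl m n p r (X Y : 'M[K]_(m, n)) (Z : 'M[K]_(p, r)) :
  (X + Y) *t Z = X *t Z + Y *t Z.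
Proof. by apply/matrixP => i j; rewrite !mxE mulrDl. Qed.

Lemma tensmxDr m n p r (X : 'M[K]_(m, n)) (Y Z : 'M[K]_(p, r)) :
  X *t (Y + Z) = X *t Y + X *t Z.
Proof. by apply/matrixP => i j; rewrite !mxE mulrDr. Qed.

Lemma tensmxZl m n p r k (X : 'M[K]_(m, n)) (Y : 'M[K]_(p, r)) :
  (k *: X) *t Y = k *: (X *t Y).
Proof. by apply/matrixP => i j; rewrite !mxE mulrA. Qed.

Lemma tensmxZr m n p r k (X : 'M[K]_(m, n)) (Y : 'M[K]_(p, r)) :
  X *t (k *: Y) = k *: (X *t Y).
Proof. by apply/matrixP => i j; rewrite !mxE mulrCA. Qed.

Lemma tensmxA m n p (X : 'M[K]_m) (Y : 'M[K]_n) (Z : 'M[K]_p) :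
  castmx (mulnA _ _ _, mulnA _ _ _) (X *t (Y *t Z)) = X *t Y *t Z.
Proof.
apply/matrixP => i j.
case: (mxtens_indexP i) => i' i3; case: (mxtens_indexP i') => i1 i2.
case: (mxtens_indexP j) => j' j3; case: (mxtens_indexP j') => j1 j2.
rewrite !tensmxE castmxE.
have E (x : 'I_m) (y : 'I_n) (z : 'I_p) :
    cast_ord (esym (mulnA m n p)) (mxtens_index (mxtens_index (x, y), z)) =
    mxtens_index (x, mxtens_index (y, z)).
  by apply: val_inj; rewrite /= mulnDl mulnA addnA.
by rewrite /= !E !tensmxE mulrA.
Qed.

Lemma castmx_linear n n' (e : n = n') k (X Y : 'M[K]_n) :
  castmx (e, e) (k *: X + Y) = k *: castmx (e, e) X + castmx (e, e) Y.
Proof. by case: n' / e; rewrite !castmx_id. Qed.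

Lemma castmxM n n' (e : n = n') (X Y : 'M[K]_n) :
  castmx (e, e) (X *m Y) = castmx (e, e) X *m castmx (e, e) Y.
Proof. by case: n' / e; rewrite !castmx_id. Qed.

Lemma castmx1 n n' (e : n = n') : castmx (e, e) (1%:M : 'M[K]_n) = 1%:M.
Proof. by case: n' / e; rewrite castmx_id. Qed.

Lemma tensmxM m n (X Y : 'M[K]_m.+1) (Z W : 'M[K]_n.+1) :
  (X * Y) *t (Z * W) = (X *t Z : 'M_(m.+1 * n.+1)) * (Y *t W).
Proof. exact/esym/(@tensmx_mul K m.+1 m.+1 n.+1 n.+1). Qed.

Lemma tensl_mor m n :
  alg_mor (fun X : 'M[K]_m.+1 => (X *t 1%:M : 'M_(m.+1 * n.+1))).
Proof.
split=> [k X Y|X Y|]; [by rewrite tensmxDl tensmxZl| |exact: (tens1mx1 m.+1 n.+1)].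
transitivity ((X * Y) *t (1 * 1 : 'M[K]_n.+1)); first by rewrite mul1r.
exact: tensmxM.
Qed.

End Kronecker.

(** * The embeddings of tensor powers of U into their completions *)

Section Completion.
Variables (K : fieldType) (q s : K).
Hypotheses (q0 : q != 0) (qq0 : q - q^-1 != 0) (sE : s ^+ 2 = q).

Lemma rep_mor n : alg_mor (@rep K q s n).
Proof. exact/Uq_lift_mor/rep_relations. Qed.

Lemma iota2_mor a b : alg_mor (fun x : Uq2 q => iota2 s x a b).
Proof.
have ma := rep_mor a; have mb := rep_mor b.
apply: tens_lift_mor => [x y z|x y z|k x y|k x y|x x' y y'|].
- by rewrite (morD ma) tensmxDl.
- by rewrite (morD mb) tensmxDr.
- by rewrite (morZ ma) tensmxZl.
- by rewrite (morZ mb) tensmxZr.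
- by rewrite (morM ma) (morM mb); apply: tensmxM.
rewrite (mor1 ma) (mor1 mb). exact: (tens1mx1 K a.+1 b.+1).
Qed.

Lemma iota3_bilin a b c :
  let f (y : Uq2 q) (z : Uq q) := iota2 s y a b *t rep s c z in
  [/\ forall x y z, f (x + y) z = f x z + f y z,
      forall x y z, f x (y + z) = f x y + f x z,
      forall k x y, f (k *: x) y = k *: f x y
    & forall k x y, f x (k *: y) = k *: f x y].
Proof.
have mab := iota2_mor a b; have mc := rep_mor c.
split=> [x y z|x y z|k x y|k x y].
- by rewrite (morD mab) tensmxDl.
- by rewrite (morD mc) tensmxDr.
- by rewrite (morZ mab) tensmxZl.
by rewrite (morZ mc) tensmxZr.
Qed.

Lemma iota3_mor a b c : alg_mor (fun x : Uq3 q => iota3 s x a b c).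
Proof.
have mab := iota2_mor a b; have mc := rep_mor c.
have [fDl fDr fZl fZr] := iota3_bilin a b c.
apply: tens_lift_mor => // [x x' y y'|].
  by rewrite (morM mab) (morM mc); apply: tensmxM.
rewrite (mor1 mab) (mor1 mc); exact: (tens1mx1 K (a.+1 * b.+1) c.+1).
Qed.

Lemma iota3_pure (x : Uq2 q) (y : Uq q) a b c :
  iota3 s (x ⊗ y) a b c = iota2 s x a b *t rep s c y.
Proof. by have [fDl fDr fZl fZr] := iota3_bilin a b c; apply: tens_lift_pure. Qed.

Definition hat_leg1 a b : leg 'M[K]_(a.+1 * b.+1) :=
  fun g => iota2 s (Uleg q g ⊗ 1) a b.
Definition hat_leg2 a b : leg 'M[K]_(a.+1 * b.+1) :=
  fun g => iota2 s (1 ⊗ Uleg q g) a b.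

Lemma hat_leg1E a b g : hat_leg1 a b g = rep s a (Uleg q g) *t 1%:M.
Proof. by rewrite /hat_leg1 iota2_pure // (mor1 (rep_mor b)). Qed.

Lemma hat_leg2E a b g : hat_leg2 a b g = 1%:M *t rep s b (Uleg q g).
Proof. by rewrite /hat_leg2 iota2_pure // (mor1 (rep_mor a)). Qed.

Definition phi12 a b c (X : 'M[K]_(a.+1 * b.+1)) : 'M[K]_(a.+1 * b.+1 * c.+1) :=
  X *t 1%:M.
Definition phi23 a b c (X : 'M[K]_(b.+1 * c.+1)) : 'M[K]_(a.+1 * b.+1 * c.+1) :=
  castmx (mulnA _ _ _, mulnA _ _ _) (1%:M *t X).

Lemma phi12_mor a b c : alg_mor (@phi12 a b c).
Proof. exact: tensl_mor. Qed.

Lemma phi23_mor a b c : alg_mor (@phi23 a b c).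
Proof.
rewrite /phi23; split=> [k X Y|X Y|].
- by rewrite tensmxDr tensmxZr castmx_linear.
- by rewrite -[RHS]castmxM tensmx_mul mulmx1.
have e := mulnA a.+1 b.+1 c.+1.
transitivity (castmx (e, e) (1%:M : 'M[K]_(a.+1 * (b.+1 * c.+1)))).
  rewrite (eq_irrelevance (mulnA _ _ _) e); congr (castmx _ _).
  exact: (tens1mx1 K a.+1 (b.+1 * c.+1)).
exact: castmx1.
Qed.

Lemma iota3_leg1 a b c g : iota3 s (Uleg1 q g) a b c = phi12 c (hat_leg1 a b g).
Proof. by rewrite iota3_pure (mor1 (rep_mor c)). Qed.

Lemma iota3_leg2 a b c g : iota3 s (Uleg2 q g) a b c = phi12 c (hat_leg2 a b g).
Proof. by rewrite iota3_pure (mor1 (rep_mor c)). Qed.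

(** The second leg has to be seen through both embeddings: [phi12] serves R_12 and [phi23] serves
    R_23. *)
Lemma iota3_leg2' a b c g : iota3 s (Uleg2 q g) a b c = phi23 a (hat_leg1 b c g).
Proof.
by rewrite iota3_leg2 /phi23 hat_leg1E tensmxA hat_leg2E.
Qed.

Lemma iota3_leg3 a b c g : iota3 s (Uleg3 q g) a b c = phi23 a (hat_leg2 b c g).
Proof.
by rewrite iota3_pure /phi23 hat_leg2E tensmxA (mor1 (iota2_mor a b)) tens1mx1.
Qed.

End Completion.

(** * The R-matrices acting on V_a ⊗ V_b ⊗ V_c *)

Section HatR.
Variables (K : fieldType) (q s : K).
Hypotheses (q0 : q != 0) (m0 : q - q^-1 != 0) (sE : s ^+ 2 = q).

(** Everything is diagonal in the second factor, so the relation is checked entry by entry in the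
    first one; [d] holds the eigenvalues of the power of q^H that T creates in the second factor. *)
Lemma qHH_conjl a b (X : 'M[K]_a.+1) (d : 'rV[K]_b.+1) :
  (forall (i k : 'I_a.+1) (j : 'I_b.+1), s ^ (wt a i * wt b j) * X i k =
    X i k * d 0 j * s ^ (wt a k * wt b j)) ->
  qHH s a b *m (X *t 1%:M) = (X *t 1%:M) *m (1%:M *t diag_mx d) *m qHH s a b.
Proof.
move=> H; rewrite -tensmx_decr; apply/matrixP => r r'.
rewrite /qHH mul_diag_mx mul_mx_diag !mxE.
set i := mxtens_unindex r; set j := mxtens_unindex r'.
have [e|_] := eqVneq i.2 j.2; last by rewrite !mulr0n !mulr0 mul0r.
by rewrite !mulr1n mulr1 e H.
Qed.

Lemma qHH_conjr a b (X : 'M[K]_b.+1) (d : 'rV[K]_a.+1) :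
  (forall (i k : 'I_b.+1) (j : 'I_a.+1), s ^ (wt a j * wt b i) * X i k =
    X i k * d 0 j * s ^ (wt a j * wt b k)) ->
  qHH s a b *m (1%:M *t X) = (1%:M *t X) *m (diag_mx d *t 1%:M) *m qHH s a b.
Proof.
move=> H; rewrite -tensmx_decl; apply/matrixP => r r'.
rewrite /qHH mul_diag_mx mul_mx_diag !mxE.
set i := mxtens_unindex r; set j := mxtens_unindex r'.
have [e|_] := eqVneq i.1 j.1; last by rewrite !mulr0n !(mulr0, mul0r).
by rewrite !mulr1n mul1r e H [_ * d _ _]mulrC.
Qed.

Lemma rep_gen n g : rep s n (Uleg q g) =
  mkleg (repE q n) (repF q n) (repK s n) (repKi s n) g.
Proof.
have rel := rep_relations q0 sE n m0.
by case: g; [apply: Uq_liftE|apply: Uq_liftF|apply: Uq_liftK|apply: Uq_liftKi].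
Qed.

Lemma qHH_hat_legs a b : qHH_like (qHH s a b) (hat_leg1 q s a b) (hat_leg2 q s a b).
Proof.
have s0 : s != 0 by apply: contraNneq q0 => s0; rewrite -sE s0 expr0n.
have wtS n i : wt n i.+1 = wt n i - 2 by rewrite /wt mulnS PoszD opprD addrCA addrC.
have sq n (d : 'rV[K]_n.+1) : diag_mx d * diag_mx d = diag_mx (\row_i (d 0 i * d 0 i)).
  exact: mulmx_diag.
have sqr n (d : 'rV[K]_n.+1) : (1%:M *t diag_mx d : 'M_(a.+1 * n.+1)) * (1%:M *t diag_mx d)
    = 1%:M *t diag_mx (\row_i (d 0 i * d 0 i)).
  by rewrite -[LHS]/(_ *m _) tensmx_mul mulmx1 mulmx_diag.
have sql n (d : 'rV[K]_n.+1) : (diag_mx d *t 1%:M : 'M_(n.+1 * b.+1)) * (diag_mx d *t 1%:M)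
    = diag_mx (\row_i (d 0 i * d 0 i)) *t 1%:M.
  by rewrite -[LHS]/(_ *m _) tensmx_mul mulmx1 mulmx_diag.
have one n : (1%:M : 'M[K]_n) = diag_mx (\row_i 1).
  by apply/matrixP => i j; rewrite !mxE.
split; split; rewrite ?hat_leg1E // ?hat_leg2E // !rep_gen ?sqr ?sql /=.
- have := @qHH_conjl a b (repK s a) (\row_i 1).
  rewrite -one tens1mx1 mulmx1; apply => i k j; rewrite !mxE mulr1.
  by case: eqP => [->|_]; rewrite ?mulr1n ?mulr0n ?mulr0 ?mul0r // mulrC.
(* E raises the weight by 2, so the exponent of s grows by 2 [wt b j], which is the eigenvalue
   exponent of q^{2H} on the second factor. The other three cases differ by the sign or the leg. *)
- apply: qHH_conjl => i k j; rewrite !mxE.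
  case: eqP => [->|_]; last by rewrite mulr0 !mul0r.
  rewrite mulrC -mulrA; congr (_ * _); rewrite -!expfzDr //; congr (_ ^ _).
  by rewrite wtS; ring.
- apply: qHH_conjl => i k j; rewrite !mxE.
  case: eqP => [->|_]; last by rewrite mulr0 !mul0r.
  rewrite mulrC -mulrA; congr (_ * _); rewrite -!expfzDr //; congr (_ ^ _).
  by rewrite wtS; ring.
- have := @qHH_conjr a b (repK s b) (\row_i 1).
  rewrite -one tens1mx1 mulmx1; apply => i k j; rewrite !mxE mulr1.
  by case: eqP => [->|_]; rewrite ?mulr1n ?mulr0n ?mulr0 ?mul0r // mulrC.
- apply: qHH_conjr => i k j; rewrite !mxE.
  case: eqP => [->|_]; last by rewrite mulr0 !mul0r.
  rewrite mulrC -mulrA; congr (_ * _); rewrite -!expfzDr //; congr (_ ^ _).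
  by rewrite wtS; ring.
apply: qHH_conjr => i k j; rewrite !mxE.
case: eqP => [->|_]; last by rewrite mulr0 !mul0r.
rewrite mulrC -mulrA; congr (_ * _); rewrite -!expfzDr //; congr (_ ^ _).
by rewrite wtS; ring.
Qed.

Lemma hat_leg_comm12_3 a b c (X : 'M[K]_(a.+1 * b.+1)) g :
  phi12 c X * phi23 a (hat_leg2 q s b c g) =
  phi23 a (hat_leg2 q s b c g) * phi12 c X.
Proof.
rewrite /phi12 /phi23 hat_leg2E // tensmxA tens1mx1.
by rewrite -[LHS]/(_ *m _) -[RHS]/(_ *m _) !tensmx_mul !mulmx1 !mul1mx.
Qed.

Lemma hat_leg_comm23_1 a b c (X : 'M[K]_(b.+1 * c.+1)) g :
  phi23 a X * phi12 c (hat_leg1 q s a b g) =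
  phi12 c (hat_leg1 q s a b g) * phi23 a X.
Proof.
rewrite /phi12 hat_leg1E // -tensmxA tens1mx1 /phi23.
rewrite -[LHS]/(_ *m _) -[RHS]/(_ *m _) -!castmxM !tensmx_mul.
by rewrite !mulmx1 !mul1mx.
Qed.

Lemma RseriesE (x : Uq2 q) a b :
  Rseries s x a b = Rsum q (iota2 s x a b) a.+1 1.
Proof. by apply: eq_bigr => n _; rewrite expr1n mulr1. Qed.

Lemma univRE a b : univR q s a b =
  qHH s a b * Rsum q (Rarg (hat_leg1 q s a b) (hat_leg2 q s a b)) a.+1 1.
Proof.
rewrite /univR RseriesE; congr (_ *m Rsum _ _ _ _).
by rewrite /Rarg -!(morM (iota2_mor q0 m0 sE a b)) !tpureM !mulr1 !mul1r.
Qed.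

Lemma univRtE a b : univRt q s a b =
  Rsum q (Rarg' (hat_leg1 q s a b) (hat_leg2 q s a b)) a.+1 1 * qHH s a b.
Proof.
rewrite /univRt RseriesE; congr (Rsum _ _ _ _ *m _).
by rewrite /Rarg' -!(morM (iota2_mor q0 m0 sE a b)) !tpureM !mulr1 !mul1r.
Qed.

Lemma Rarg_nilp a b :
  Rarg (hat_leg1 q s a b) (hat_leg2 q s a b) ^+ a.+1 = 0.
Proof.
rewrite /Rarg -!(morM (iota2_mor q0 m0 sE a b)) !tpureM !mulr1 !mul1r.
exact: iota2_xE_nilp.
Qed.

Lemma Rarg'_nilp a b :
  Rarg' (hat_leg1 q s a b) (hat_leg2 q s a b) ^+ a.+1 = 0.
Proof.
rewrite /Rarg' -!(morM (iota2_mor q0 m0 sE a b)) !tpureM !mulr1 !mul1r.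
exact: iota2_xF_nilp.
Qed.

Section Conjugations.
Variables (a b c : nat).
Hypotheses (h0 : q + q^-1 != 0) (qn0 : forall n, qnum q n.+1 != 0).
Local Notation A := 'M[K]_(a.+1 * b.+1 * c.+1).
Local Notation f12 := (@phi12 K a b c).
Local Notation f23 := (@phi23 K a b c).
Local Notation iota := (fun x : Uq3 q => iota3 s x a b c).
Let m12 := phi12_mor K a b c.
Let m23 := phi23_mor K a b c.
Let m3 := iota3_mor q0 m0 sE a b c.

Let E1 : iota \o Uleg1 q = f12 \o hat_leg1 q s a b.
Proof. by apply: funext => g; apply: iota3_leg1. Qed.
Let E2 : iota \o Uleg2 q = f12 \o hat_leg2 q s a b.
Proof. by apply: funext => g; apply: iota3_leg2. Qed.
Let E2' : iota \o Uleg2 q = f23 \o hat_leg1 q s b c.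
Proof. by apply: funext => g; apply: iota3_leg2'. Qed.
Let E3 : iota \o Uleg3 q = f23 \o hat_leg2 q s b c.
Proof. by apply: funext => g; apply: iota3_leg3. Qed.

Let L : leg_triple q (iota \o Uleg1 q) (iota \o Uleg2 q) (iota \o Uleg3 q).
Proof.
have [[r1 r2 r3] [cm12 cm13 cm23]] := Uleg_triple q.
by split; split; by [apply: mor_is_leg|apply: mor_leg_comm].
Qed.

Let iota_C13 : iota3 s (C13 q) a b c = cas q (comul (iota \o Uleg1 q) (iota \o Uleg3 q)).
Proof. by rewrite C13E // (mor_cas_comul q m3). Qed.

Let mor_Rarg (B : algType K) (f : B -> A) (l l' : leg B) : alg_mor f ->
  Rarg (f \o l) (f \o l') = f (Rarg l l').
Proof. by move=> fm; rewrite /Rarg !(morM fm). Qed.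

Let mor_Rarg' (B : algType K) (f : B -> A) (l l' : leg B) : alg_mor f ->
  Rarg' (f \o l) (f \o l') = f (Rarg' l l').
Proof. by move=> fm; rewrite /Rarg' !(morM fm). Qed.

Lemma aw13_univR :
  iota3 s (aw13 q (Uleg1 q) (Uleg2 q) (Uleg3 q)) a b c * f12 (univR q s a b) =
  f12 (univR q s a b) * iota3 s (C13 q) a b c.
Proof.
rewrite iota_C13 univRE (morM m12) (mor_Rsum q m12) -mor_Rarg // -E1 -E2.
rewrite (mor_aw13 q m3); apply: aw13_R12 => //.
- by rewrite E1 E2; apply: (mor_qHH_like m12); apply: qHH_hat_legs.
- by move=> g; rewrite E3; apply: hat_leg_comm12_3.
by rewrite E1 E2 mor_Rarg // -(morX m12) Rarg_nilp (mor0 m12).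
Qed.

Lemma aw13op_univR :
  iota3 s (aw13op q (Uleg1 q) (Uleg2 q) (Uleg3 q)) a b c * f23 (univR q s b c) =
  f23 (univR q s b c) * iota3 s (C13 q) a b c.
Proof.
rewrite iota_C13 univRE (morM m23) (mor_Rsum q m23) -mor_Rarg // -E2' -E3.
rewrite (mor_aw13op q m3); apply: aw13op_R23 => //.
- by rewrite E2' E3; apply: (mor_qHH_like m23); apply: qHH_hat_legs.
- by move=> g; rewrite E1; apply: hat_leg_comm23_1.
by rewrite E2' E3 mor_Rarg // -(morX m23) Rarg_nilp (mor0 m23).
Qed.

Lemma univRt_aw13op :
  f12 (univRt q s a b) * iota3 s (aw13op q (Uleg1 q) (Uleg2 q) (Uleg3 q)) a b c =
  iota3 s (C13 q) a b c * f12 (univRt q s a b).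
Proof.
rewrite iota_C13 univRtE (morM m12) (mor_Rsum q m12) -mor_Rarg' // -E1 -E2.
rewrite (mor_aw13op q m3); apply: aw13op_R12 => //.
- by rewrite E1 E2; apply: (mor_qHH_like m12); apply: qHH_hat_legs.
- by move=> g; rewrite E3; apply: hat_leg_comm12_3.
by rewrite E1 E2 mor_Rarg' // -(morX m12) Rarg'_nilp (mor0 m12).
Qed.

Lemma univRt_aw13 :
  f23 (univRt q s b c) * iota3 s (aw13 q (Uleg1 q) (Uleg2 q) (Uleg3 q)) a b c =
  iota3 s (C13 q) a b c * f23 (univRt q s b c).
Proof.
rewrite iota_C13 univRtE (morM m23) (mor_Rsum q m23) -mor_Rarg' // -E2' -E3.
rewrite (mor_aw13 q m3); apply: aw13_R23 => //.
- by rewrite E2' E3; apply: (mor_qHH_like m23); apply: qHH_hat_legs.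
- by move=> g; rewrite E1; apply: hat_leg_comm23_1.
by rewrite E2' E3 mor_Rarg' // -(morX m23) Rarg'_nilp (mor0 m23).
Qed.
End Conjugations.
End HatR.

Lemma hat3_ext (K : fieldType) (X Y : hat3 K) :
  (forall a b c, X a b c = Y a b c) -> X = Y.
Proof.
move=> XY; apply: functional_extensionality_dep => a.
apply: functional_extensionality_dep => b.
by apply: functional_extensionality_dep => c.
Qed.

Lemma mor_unitmx (K : fieldType) n p (f : 'M[K]_n.+1 -> 'M[K]_p.+1) X :
  alg_mor f -> X \in unitmx -> f X \in unitmx.
Proof.
move=> fm Xu; have : f X *m f (invmx X) = 1%:M.
  by rewrite -[LHS]/(f X * _) -(morM fm) -[X * _]/(X *m _) mulmxV // (mor1 fm).
by case/mulmx1_unit.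
Qed.

Lemma conjmx_eq (K : fieldType) n (X Y R : 'M[K]_n) : R \in unitmx ->
  X *m R = R *m Y -> X = R *m Y *m invmx R.
Proof. by move=> Ru <-; rewrite mulmxK. Qed.

Lemma conjVmx_eq (K : fieldType) n (X Y R : 'M[K]_n) : R \in unitmx ->
  R *m X = Y *m R -> X = invmx R *m Y *m R.
Proof. by move=> Ru e; rewrite -mulmxA -e mulKmx. Qed.

Theorem corollary4p1 (R : realType) (q s : R[i]) (q_neq0 : q != 0)
    (q_not_root : forall n : nat, (0 < n)%N -> q ^+ n != 1)
    (s_sqrt : s ^+ 2 = q) :
  exists C13_0 C13_1 : Uq3 q,
    [/\ iota3 s C13_0
          = hat3_mul (hat3_mul (hat3_inv (leg23 (univRt q s)))
                               (iota3 s (C13 q)))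
                     (leg23 (univRt q s)),
        iota3 s C13_0
          = hat3_mul (hat3_mul (leg12 (univR q s)) (iota3 s (C13 q)))
                     (hat3_inv (leg12 (univR q s))),
        iota3 s C13_1
          = hat3_mul (hat3_mul (hat3_inv (leg12 (univRt q s)))
                               (iota3 s (C13 q)))
                     (leg12 (univRt q s))
      & iota3 s C13_1
          = hat3_mul (hat3_mul (leg23 (univR q s)) (iota3 s (C13 q)))
                     (hat3_inv (leg23 (univR q s)))]
    /\
    [/\ (q - q^-1)^-1 *: qcomm C13_0 (C12 q)
          = C23 q + C2 q * C3 q + C1 q * C123 q,
        (q - q^-1)^-1 *: qcomm (C23 q) C13_0
          = C12 q + C1 q * C2 q + C3 q * C123 q,
        (q - q^-1)^-1 *: qcomm (C23 q) (C12 q)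
          = C13_1 + C1 q * C3 q + C2 q * C123 q,
        (q - q^-1)^-1 *: qcomm (C12 q) C13_1
          = C23 q + C2 q * C3 q + C1 q * C123 q
      & (q - q^-1)^-1 *: qcomm C13_1 (C23 q)
          = C12 q + C1 q * C2 q + C3 q * C123 q].
Proof.
(* The scalars q - q^-1, q + q^-1 and [n+1] can vanish only if q^2, q^4 and q^{2n+2}, respectively,
   equal 1. *)
have m0 : q - q^-1 != 0.
  apply: contraNneq (q_not_root 2 isT) => /subr0_eq e.
  by rewrite expr2 {2}e mulfV.
have h0 : q + q^-1 != 0.
  apply: contraNneq (q_not_root 4 isT) => e.
  have q2 : q * q = -1.
    by apply/eqP; rewrite -addr_eq0 -[X in _ + X](mulfV q_neq0) -mulrDr e mulr0.
  by rewrite !exprS expr0 mulr1 mulrA q2 mulN1r opprK.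
have qn0 n : qnum q n.+1 != 0.
  rewrite mulf_neq0 ?invr_eq0 // subr_eq0.
  apply: contraNneq (q_not_root (n.+1 + n.+1)%N isT) => e.
  by rewrite exprD {2}e mulfV ?expf_neq0.
have L := Uleg_triple q.
exists (aw13 q (Uleg1 q) (Uleg2 q) (Uleg3 q)).
exists (aw13op q (Uleg1 q) (Uleg2 q) (Uleg3 q)).
split; split.
- apply: hat3_ext => a b c; apply: conjVmx_eq; last exact: univRt_aw13.
  exact: (mor_unitmx (phi23_mor _ _ _ _) (univRt_unit q_neq0 m0 s_sqrt b c)).
- apply: hat3_ext => a b c; apply: conjmx_eq; last exact: aw13_univR.
  exact: (mor_unitmx (phi12_mor _ _ _ _) (univR_unit q_neq0 m0 s_sqrt a b)).
- apply: hat3_ext => a b c; apply: conjVmx_eq; last exact: univRt_aw13op.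
  exact: (mor_unitmx (phi12_mor _ _ _ _) (univRt_unit q_neq0 m0 s_sqrt a b)).
- apply: hat3_ext => a b c; apply: conjmx_eq; last exact: aw13op_univR.
  exact: (mor_unitmx (phi23_mor _ _ _ _) (univR_unit q_neq0 m0 s_sqrt b c)).
- rewrite C12E // C23E // C123E // C1E C2E C3E.
  exact: aw13_qbracket12.
- rewrite C12E // C23E // C123E // C1E C2E C3E.
  exact: qbracket23_aw13.
- rewrite C12E // C23E // C123E // C1E C2E C3E.
  exact: qbracket23_12.
- rewrite C12E // C23E // C123E // C1E C2E C3E.
  exact: qbracket12_aw13op.
rewrite C12E // C23E // C123E // C1E C2E C3E.
exact: aw13op_qbracket23.
Qed.
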